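(* Let $M$ be non-zero in $\mathsf{D}^{\mathrm{c}}(R)$. Let $P$ be locally finite in $\mathsf{D}(R^{\mathrm{o}})$ and suppose $\operatorname{amp} P < \infty$. Then $$\operatorname{amp}(P \otimes^{\mathrm{L}}_R M) \geq \operatorname{amp} P.$$
   Context: $k$ is a field and $R$ is a cochain Differential Graded (DG) algebra over $k$ (cohomologically graded) of the form $\cdots \to 0 \to k \to 0 \to R^2 \to R^3 \to \cdots$, i.e. $R^j = 0$ for $j<0$, $R^0 = k$, $R^1 = 0$, with $\dim_k \mathrm{H}^j(R) < \infty$ for each $j$. $\mathsf{D}(R)$ and $\mathsf{D}(R^{\mathrm{o}})$ are the derived categories of DG left-$R$-modules and DG right-$R$-modules, and $\otimes^{\mathrm{L}}_R$ is the left derived tensor product. A DG left-$R$-module is in $\mathsf{D}^{\mathrm{c}}(R)$ (compact) precisely if it is finitely built from $R$ in $\mathsf{D}(R)$ using distinguished triangles, (de)suspensions, finite direct sums and direct summands. ''Non-zero'' means not isomorphic to $0$ in the derived category. A DG $R$-module $N$ is locally finite if $\dim_k \mathrm{H}^j(N) < \infty$ for each $j$. For a DG module (or complex) $N$: $\inf N = \inf\{ j \mid \mathrm{H}^j(N) \neq 0\}$, $\sup N = \sup\{ j \mid \mathrm{H}^j(N)\neq 0\}$, $\operatorname{amp} N = \sup N - \inf N$, with the conventions $\inf \varnothing = \infty$, $\sup\varnothing = -\infty$, so $\operatorname{amp} 0 = -\infty$. *)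

(* Defs.v *)
From HB Require Import structures.
From mathcomp Require Import all_boot all_order all_algebra generic_quotient.
From mathcomp Require Import boolp classical_sets constructive_ereal.

Set Implicit Arguments.
Unset Strict Implicit.
Unset Printing Implicit Defensive.

Import Order.TTheory GRing.Theory Num.Theory.
Local Open Scope ring_scope.

(* Graded objects are families indexed by [int].  An operation landing in     *)
(* degree [i + j] takes the target degree [n] and a proof of [i + j = n] as   *)
(* arguments, which avoids transports along equations between degrees; such   *)
(* proofs are unique ([int] has decidable equality).                          *)

Lemma sgnS (k : fieldType) (i j : int) :
  i + 1 = j -> (-1 : k) ^ j = - (-1 : k) ^ i.
Proof. by move=> <-; rewrite expfzDr ?oppr_eq0 ?oner_eq0 // expr1z mulrN1. Qed.

Lemma sgnK (k : fieldType) (i : int) : (-1 : k) ^ i * (-1) ^ i = 1.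
Proof. by rewrite -expfzMl mulrNN mulr1 exp1rz. Qed.

Lemma degS (i j n : int) : i + j = n -> i + (j + 1) = n + 1.
Proof. by move=> <-; rewrite addrA. Qed.

Lemma degS2 (i j : int) : i + 1 = j -> i + 1 + 1 = j + 1.
Proof. by move=> <-. Qed.

Record complex (k : fieldType) := Complex {
  cx_car :> int -> lmodType k;
  cx_d : forall i j : int, i + 1 = j -> cx_car i -> cx_car j;
  cx_lin : forall (i j : int) (h : i + 1 = j), linear (cx_d h);
  cx_dd : forall (i j l : int) (h : i + 1 = j) (h' : j + 1 = l) (x : cx_car i),
    cx_d h' (cx_d h x) = 0 }.

HB.instance Definition _ (k : fieldType) (C : complex k) (i j : int)
    (h : i + 1 = j) :=
  GRing.isLinear.Build k (C i) (C j) _ (@cx_d k C i j h) (cx_lin h).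

Section Cohomology.
Variable k : fieldType.
Implicit Types C D : complex k.

Definition cocycle C (j : int) (x : C j) : Prop :=
  forall (l : int) (h : j + 1 = l), cx_d h x = 0.

Definition coboundary C (j : int) (x : C j) : Prop :=
  exists (i : int) (h : i + 1 = j) (y : C i), cx_d h y = x.

Definition H_nonzero C (j : int) : Prop :=
  exists x : C j, cocycle x /\ ~ coboundary x.

Definition H_findim C (j : int) : Prop :=
  exists (m : nat) (z : 'I_m -> C j), (forall t, cocycle (z t)) /\
    forall x : C j, cocycle x ->
    exists c : 'I_m -> k, coboundary (x - \sum_t c t *: z t).

Definition locally_finite C : Prop := forall j : int, H_findim C j.

Local Open Scope classical_set_scope.

Definition cx_inf C : \bar int :=
  infimum +oo%E [set j%:E | j in [set j : int | H_nonzero C j]].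

Definition cx_sup C : \bar int :=
  supremum -oo%E [set j%:E | j in [set j : int | H_nonzero C j]].

(* For acyclic [C] this is [-oo - +oo], which is [-oo] in [\bar int]; a sum   *)
(* of opposite infinities never occurs.                                       *)
Definition amp C : \bar int := (cx_sup C - cx_inf C)%E.

Definition acyclic C : Prop := forall j : int, ~ H_nonzero C j.

End Cohomology.

Record dgAlgebra (k : fieldType) := DGAlgebra {
  dga_cx :> complex k;
  dga_one : dga_cx 0;
  dga_mul : forall i j n : int, i + j = n -> dga_cx i -> dga_cx j -> dga_cx n;
  dga_mul_linr : forall (i j n : int) (h : i + j = n) (x : dga_cx i),
    linear (dga_mul h x);
  dga_mul_linl : forall (i j n : int) (h : i + j = n) (y : dga_cx j),
    linear (fun x => dga_mul h x y);
  dga_mulA : forall (a b c ab bc n : int) (h1 : a + b = ab) (h2 : ab + c = n)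
      (h3 : b + c = bc) (h4 : a + bc = n)
      (x : dga_cx a) (y : dga_cx b) (z : dga_cx c),
    dga_mul h4 x (dga_mul h3 y z) = dga_mul h2 (dga_mul h1 x y) z;
  dga_mul1 : forall (i : int) (h : 0 + i = i) (x : dga_cx i),
    dga_mul h dga_one x = x;
  dga_mulr1 : forall (i : int) (h : i + 0 = i) (x : dga_cx i),
    dga_mul h x dga_one = x;
  dga_leibniz : forall (i j n i1 j1 n1 : int) (h : i + j = n) (hn : n + 1 = n1)
      (hi : i + 1 = i1) (hj : j + 1 = j1) (h1 : i1 + j = n1) (h2 : i + j1 = n1)
      (x : dga_cx i) (y : dga_cx j),
    cx_d hn (dga_mul h x y) =
      dga_mul h1 (cx_d hi x) y + (-1) ^ i *: dga_mul h2 x (cx_d hj y) }.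

Record dgLeft (k : fieldType) (R : dgAlgebra k) := DGLeft {
  dgl_cx :> complex k;
  lact : forall i j n : int, i + j = n -> R i -> dgl_cx j -> dgl_cx n;
  lact_linr : forall (i j n : int) (h : i + j = n) (r : R i),
    linear (lact h r);
  lact_linl : forall (i j n : int) (h : i + j = n) (x : dgl_cx j),
    linear (fun r => lact h r x);
  lactA : forall (a b c ab bc n : int) (h1 : a + b = ab) (h2 : ab + c = n)
      (h3 : b + c = bc) (h4 : a + bc = n) (r : R a) (s : R b) (x : dgl_cx c),
    lact h4 r (lact h3 s x) = lact h2 (dga_mul h1 r s) x;
  lact1 : forall (i : int) (h : 0 + i = i) (x : dgl_cx i),
    lact h (dga_one R) x = x;
  lact_leibniz : forall (i j n i1 j1 n1 : int) (h : i + j = n) (hn : n + 1 = n1)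
      (hi : i + 1 = i1) (hj : j + 1 = j1) (h1 : i1 + j = n1) (h2 : i + j1 = n1)
      (r : R i) (x : dgl_cx j),
    cx_d hn (lact h r x) =
      lact h1 (cx_d hi r) x + (-1) ^ i *: lact h2 r (cx_d hj x) }.

Record dgRight (k : fieldType) (R : dgAlgebra k) := DGRight {
  dgr_cx :> complex k;
  ract : forall i j n : int, i + j = n -> dgr_cx i -> R j -> dgr_cx n;
  ract_linr : forall (i j n : int) (h : i + j = n) (p : dgr_cx i),
    linear (ract h p);
  ract_linl : forall (i j n : int) (h : i + j = n) (r : R j),
    linear (fun p => ract h p r);
  ractA : forall (a b c ab bc n : int) (h1 : a + b = ab) (h2 : ab + c = n)
      (h3 : b + c = bc) (h4 : a + bc = n) (p : dgr_cx a) (r : R b) (s : R c),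
    ract h2 (ract h1 p r) s = ract h4 p (dga_mul h3 r s);
  ract1 : forall (i : int) (h : i + 0 = i) (p : dgr_cx i),
    ract h p (dga_one R) = p;
  ract_leibniz : forall (i j n i1 j1 n1 : int) (h : i + j = n) (hn : n + 1 = n1)
      (hi : i + 1 = i1) (hj : j + 1 = j1) (h1 : i1 + j = n1) (h2 : i + j1 = n1)
      (p : dgr_cx i) (r : R j),
    cx_d hn (ract h p r) =
      ract h1 (cx_d hi p) r + (-1) ^ i *: ract h2 p (cx_d hj r) }.

HB.instance Definition _ (k : fieldType) (R : dgAlgebra k) (M : dgLeft R)
    (i j n : int) (h : i + j = n) (r : R i) :=
  GRing.isLinear.Build k (M j) (M n) _ (@lact k R M i j n h r) (lact_linr h r).

HB.instance Definition _ (k : fieldType) (R : dgAlgebra k) (P : dgRight R)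
    (i j n : int) (h : i + j = n) (p : P i) :=
  GRing.isLinear.Build k (R j) (P n) _ (@ract k R P i j n h p) (ract_linr h p).

Record dgHom (k : fieldType) (R : dgAlgebra k) (M N : dgLeft R) := DGHom {
  dgh :> forall i : int, M i -> N i;
  dgh_lin : forall i : int, linear (@dgh i);
  dgh_d : forall (i j : int) (h : i + 1 = j) (x : M i),
    dgh (cx_d h x) = cx_d h (dgh x);
  dgh_act : forall (i j n : int) (h : i + j = n) (r : R i) (x : M j),
    dgh (lact h r x) = lact h r (dgh x) }.

HB.instance Definition _ (k : fieldType) (R : dgAlgebra k) (M N : dgLeft R)
    (f : dgHom M N) (i : int) :=
  GRing.isLinear.Build k (M i) (N i) _ (@dgh k R M N f i) (@dgh_lin _ _ _ _ f i).

#[local] Obligation Tactic := idtac.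

Section Constructions.
Variables (k : fieldType) (R : dgAlgebra k).
Implicit Types M N : dgLeft R.

Program Definition dg_id M : dgHom M M := @DGHom k R M M (fun _ x => x) _ _ _.
Next Obligation. by []. Qed.
Next Obligation. by []. Qed.
Next Obligation. by []. Qed.

Program Definition dg_comp L M N (g : dgHom M N) (f : dgHom L M) : dgHom L N :=
  @DGHom k R L N (fun _ x => g _ (f _ x)) _ _ _.
Next Obligation. by move=> L M N g f i a x y; rewrite !linearP. Qed.
Next Obligation. by move=> L M N g f i j h x /=; rewrite !dgh_d. Qed.
Next Obligation. by move=> L M N g f i j n h r x /=; rewrite !dgh_act. Qed.

Definition dg_regular : dgLeft R :=
  DGLeft (@dga_mul_linr k R) (@dga_mul_linl k R) (@dga_mulA k R)
    (@dga_mul1 k R) (@dga_leibniz k R).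

Program Definition cx_zero : complex k :=
  @Complex k (fun _ => 'rV[k]_0) (fun _ _ _ _ => 0) _ _.
Next Obligation. by move=> i j h a x y; rewrite scaler0 addr0. Qed.
Next Obligation. by []. Qed.

Program Definition dg_zero : dgLeft R :=
  @DGLeft k R cx_zero (fun _ _ _ _ _ _ => 0) _ _ _ _ _.
Next Obligation. by move=> i j n h r a x y; rewrite scaler0 addr0. Qed.
Next Obligation. by move=> i j n h x a r s; rewrite scaler0 addr0. Qed.
Next Obligation. by []. Qed.
Next Obligation. by move=> i h x; rewrite [RHS]thinmx0. Qed.
Next Obligation.
by move=> i j n i1 j1 n1 h hn hi hj h1 h2 r x; rewrite scaler0 addr0.
Qed.

Program Definition cx_sum (C D : complex k) : complex k :=
  @Complex k (fun i => (C i * D i)%type)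
    (fun _ _ h x => (cx_d h x.1, cx_d h x.2)) _ _.
Next Obligation. by move=> C D i j h a x y; rewrite /= !linearP. Qed.
Next Obligation. by move=> C D i j l h h' x; rewrite /= !cx_dd. Qed.

Program Definition dg_sum M N : dgLeft R :=
  @DGLeft k R (cx_sum M N)
    (fun _ _ _ h r x => (lact h r x.1, lact h r x.2)) _ _ _ _ _.
Next Obligation. by move=> M N i j n h r a x y; rewrite /= !linearP. Qed.
Next Obligation. by move=> M N i j n h x a r s; rewrite /= !lact_linl. Qed.
Next Obligation. by move=> M N *; congr pair; apply: lactA. Qed.
Next Obligation. by move=> M N i h [x y]; rewrite /= !lact1. Qed.
Next Obligation. by move=> M N *; congr pair; apply: lact_leibniz. Qed.

(* The suspension [dg_shift M] is, in degree i, M in degree i + 1.            *)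
Program Definition cx_shift (C : complex k) : complex k :=
  @Complex k (fun i => C (i + 1)) (fun _ _ h x => - cx_d (degS2 h) x) _ _.
Next Obligation.
by move=> C i j h a x y; rewrite linearP opprD scalerN.
Qed.
Next Obligation.
by move=> C i j l h h' x; rewrite /= linearN /= cx_dd !oppr0.
Qed.

Program Definition dg_shift M : dgLeft R :=
  @DGLeft k R (cx_shift M)
    (fun i _ _ h r x => (-1) ^ i *: lact (degS h) r x) _ _ _ _ _.
Next Obligation.
by move=> M i j n h r a x y; rewrite linearP scalerDr !scalerA [_ * a]mulrC.
Qed.
Next Obligation.
by move=> M i j n h x a r s; rewrite lact_linl scalerDr !scalerA [_ * a]mulrC.
Qed.
Next Obligation.
move=> M a b c ab bc n h1 h2 h3 h4 r s x /=.
rewrite linearZ /= (lactA h1 (degS h2)) scalerA -expfzDr ?h1 //.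
by rewrite oppr_eq0 oner_eq0.
Qed.
Next Obligation. by move=> M i h x; rewrite /= lact1 expr0z scale1r. Qed.
Next Obligation.
move=> M i j n i1 j1 n1 h hn hi hj h1 h2 r x.
rewrite /= linearZ /= (lact_leibniz (degS h) _ hi (degS2 hj) (degS h1) (degS h2)).
by rewrite (sgnS _ hi) linearN scaleNr !scalerN scalerDr opprD.
Qed.

(* cone f = N (+) M[1], with d (y, x) = (d y + f x, - d x).                   *)
Program Definition cx_cone M N (f : dgHom M N) : complex k :=
  @Complex k (fun i => (N i * M (i + 1)%R)%type)
    (fun i j h z => (cx_d h z.1 + f j (ecast a (M a) h z.2),
                     - cx_d (degS2 h) z.2)) _ _.
Next Obligation.
move=> M N f i j h a [y x] [y' x']; congr pair => /=; last first.
  by rewrite linearP opprD scalerN.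
by case: j / h => /=; rewrite !linearP scalerDr addrACA.
Qed.
Next Obligation.
move=> M N f i j l h h' [y x] /=; rewrite linearN /= cx_dd !oppr0; congr pair.
case: l / h'; case: j / h => /=.
rewrite linearD /= cx_dd add0r linearN -dgh_d /=.
by rewrite (eq_irrelevance (degS2 _) erefl) subrr.
Qed.

Program Definition dg_cone M N (f : dgHom M N) : dgLeft R :=
  @DGLeft k R (cx_cone f)
    (fun i _ _ h r z => (lact h r z.1, (-1) ^ i *: lact (degS h) r z.2))
    _ _ _ _ _.
Next Obligation.
move=> M N f i j n h r a x y; congr pair; first exact: lact_linr.
exact: (lact_linr (d := dg_shift M)).
Qed.
Next Obligation.
move=> M N f i j n h x a r s; congr pair; first exact: lact_linl.
exact: (lact_linl (d := dg_shift M)).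
Qed.
Next Obligation.
move=> M N f a b c ab bc n h1 h2 h3 h4 r s z; congr pair; first exact: lactA.
exact: (lactA (d := dg_shift M)).
Qed.
Next Obligation.
by move=> M N f i h [x y]; rewrite /= !lact1 expr0z scale1r.
Qed.
Next Obligation.
move=> M N f i j n i1 j1 n1 h hn hi hj h1 h2 r z; congr pair; last first.
  exact: (lact_leibniz (d := dg_shift M)).
rewrite /= (lact_leibniz h hn hi hj h1 h2) linearD scalerDr /= -addrA.
congr (_ + (_ + _)).
case: n1 / hn h1 h2 => h1 h2; case: j1 / hj h2 => h2 /=.
rewrite linearZ /= dgh_act; congr (_ *: lact _ _ _).
exact: eq_irrelevance.
Qed.

End Constructions.

Section Derived.
Variables (k : fieldType) (R : dgAlgebra k).
Implicit Types L M N : dgLeft R.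

(* H(f) is bijective in every degree.                                         *)
Definition quasi_iso M N (f : dgHom M N) : Prop :=
  forall i : int,
    (forall x : M i, cocycle x -> coboundary (f i x) -> coboundary x) /\
    (forall y : N i, cocycle y ->
       exists x : M i, cocycle x /\ coboundary (f i x - y)).

(* D(R) is the localisation of the category of DG modules at the              *)
(* quasi-isomorphisms: a morphism is a formal composite of DG homomorphisms   *)
(* and inverses of quasi-isomorphisms, taken modulo [dm_eq].                  *)
Inductive dmor : dgLeft R -> dgLeft R -> Type :=
| dm_map M N (f : dgHom M N) : dmor M N
| dm_inv M N (s : dgHom M N) (hs : quasi_iso s) : dmor N M
| dm_comp L M N (v : dmor M N) (u : dmor L M) : dmor L N.

Inductive dm_eq : forall M N, dmor M N -> dmor M N -> Prop :=
| dm_refl M N (u : dmor M N) : dm_eq u u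
| dm_sym M N (u v : dmor M N) : dm_eq u v -> dm_eq v u
| dm_trans M N (u v w : dmor M N) : dm_eq u v -> dm_eq v w -> dm_eq u w
| dm_congr L M N (v v' : dmor M N) (u u' : dmor L M) :
    dm_eq v v' -> dm_eq u u' -> dm_eq (dm_comp v u) (dm_comp v' u')
| dm_assoc K L M N (w : dmor M N) (v : dmor L M) (u : dmor K L) :
    dm_eq (dm_comp w (dm_comp v u)) (dm_comp (dm_comp w v) u)
| dm_idl M N (u : dmor M N) : dm_eq (dm_comp (dm_map (dg_id N)) u) u
| dm_idr M N (u : dmor M N) : dm_eq (dm_comp u (dm_map (dg_id M))) u
| dm_map_comp L M N (g : dgHom M N) (f : dgHom L M) :
    dm_eq (dm_map (dg_comp g f)) (dm_comp (dm_map g) (dm_map f))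
| dm_invl M N (s : dgHom M N) (hs : quasi_iso s) :
    dm_eq (dm_comp (dm_inv hs) (dm_map s)) (dm_map (dg_id M))
| dm_invr M N (s : dgHom M N) (hs : quasi_iso s) :
    dm_eq (dm_comp (dm_map s) (dm_inv hs)) (dm_map (dg_id N)).

Definition D_iso M N : Prop :=
  exists (u : dmor M N) (v : dmor N M),
    dm_eq (dm_comp v u) (dm_map (dg_id M)) /\
    dm_eq (dm_comp u v) (dm_map (dg_id N)).

(* There is a distinguished triangle L -> M -> N -> L[1] in D(R), i.e. one    *)
(* isomorphic to the triangle X -> Y -> cone f -> X[1] of some f : X -> Y.    *)
Definition D_triangle L M N : Prop :=
  exists (X Y : dgLeft R) (f : dgHom X Y),
    [/\ D_iso L X, D_iso M Y & D_iso N (dg_cone f)].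

(* The class is closed under [dg_shift] in both directions, hence under       *)
(* rotating triangles: [D_compact_triangle] yields any vertex of a triangle   *)
(* from the other two.                                                        *)
Inductive D_compact : dgLeft R -> Prop :=
| D_compact_regular : D_compact (dg_regular R)
| D_compact_iso M N : D_iso M N -> D_compact M -> D_compact N
| D_compact_triangle L M N : D_triangle L M N ->
    D_compact L -> D_compact M -> D_compact N
| D_compact_shift M : D_compact M -> D_compact (dg_shift M)
| D_compact_unshift M : D_compact (dg_shift M) -> D_compact M
| D_compact_zero : D_compact (dg_zero R)
| D_compact_sum M N : D_compact M -> D_compact N -> D_compact (dg_sum M N)
| D_compact_summand M N : D_compact (dg_sum M N) -> D_compact M.

Definition null_homotopic M N (f : dgHom M N) : Prop :=
  exists s : forall i j : int, j + 1 = i -> M i -> N j,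
    [/\ forall (i j : int) (h : j + 1 = i), linear (s i j h),
        forall (a i j n l : int) (hi : a + i = n) (h : j + 1 = i)
            (hn : l + 1 = n) (hj : a + j = l) (r : R a) (x : M i),
          s n l hn (lact hi r x) = (-1) ^ a *: lact hj r (s i j h x) &
        forall (i j l : int) (h : j + 1 = i) (h' : i + 1 = l) (x : M i),
          f i x = cx_d h (s i j h x) + s l i h' (cx_d h' x)].

Definition K_projective M : Prop :=
  forall (N : dgLeft R) (f : dgHom M N), acyclic N -> null_homotopic f.

Record resolution M := Resolution {
  res_obj : dgLeft R;
  res_map : dgHom res_obj M;
  res_qis : quasi_iso res_map;
  res_proj : K_projective res_obj }.

End Derived.

Section Tensor.
Variables (k : fieldType) (R : dgAlgebra k) (P : dgRight R) (M : dgLeft R).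

Record balanced (n : int) (V : lmodType k) := Balanced {
  bal :> forall i j : int, i + j = n -> P i -> M j -> V;
  bal_linr : forall (i j : int) (h : i + j = n) (p : P i), linear (bal h p);
  bal_linl : forall (i j : int) (h : i + j = n) (x : M j),
    linear (fun p => bal h p x);
  balA : forall (a b c ab bc : int) (h1 : a + b = ab) (h2 : ab + c = n)
      (h3 : b + c = bc) (h4 : a + bc = n) (p : P a) (r : R b) (x : M c),
    bal h2 (ract h1 p r) x = bal h4 p (lact h3 r x) }.

HB.instance Definition _ (n : int) (V : lmodType k) (f : balanced n V)
    (i j : int) (h : i + j = n) (p : P i) :=
  GRing.isLinear.Build k (M j) V _ (@bal n V f i j h p) (bal_linr f h p).

Inductive tgen (n : int) : Type :=
  Tgen (i j : int) (h : i + j = n) (p : P i) (x : M j).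

Definition tev_gen n V (f : balanced n V) (g : tgen n) : V :=
  let: Tgen _ _ h p x := g in f _ _ h p x.

Definition tev n V (f : balanced n V) (s : seq (tgen n)) : V :=
  \sum_(g <- s) tev_gen f g.

(* The degree n part of the tensor product is the type of formal sums of      *)
(* generators p (x) m, two formal sums being identified when every balanced   *)
(* map takes the same value on both: this is the quotient having the          *)
(* universal property of the tensor product.                                  *)
Definition teq n (s t : {classic seq (tgen n)}) : bool :=
  `[< forall (V : lmodType k) (f : balanced n V), tev f s = tev f t >].

Lemma teq_refl n : reflexive (@teq n).
Proof. by move=> s; apply/asboolP. Qed.

Lemma teq_sym n : symmetric (@teq n).
Proof. by move=> s t; apply/asboolP/asboolP => e V f; rewrite e. Qed.

Lemma teq_trans n : transitive (@teq n).
Proof.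
by move=> t s u /asboolP e1 /asboolP e2; apply/asboolP => V f; rewrite e1.
Qed.

Definition teq_equiv n : equiv_rel {classic seq (tgen n)} :=
  EquivRel (@teq n) (@teq_refl n) (@teq_sym n) (@teq_trans n).

Definition tens_car (n : int) : Type := {eq_quot teq_equiv n}%qT.
HB.instance Definition _ n := Choice.on (tens_car n).
HB.instance Definition _ n := EqQuotient.on (tens_car n).

Definition tens_pi n (s : seq (tgen n)) : tens_car n :=
  (\pi_(tens_car n) (s : {classic seq (tgen n)}))%qT.

Definition tens_repr n (x : tens_car n) : seq (tgen n) := repr x.

Definition tens_ev n V (f : balanced n V) (x : tens_car n) : V :=
  tev f (tens_repr x).

Lemma tens_ext n (x y : tens_car n) :
  (forall (V : lmodType k) (f : balanced n V), tens_ev f x = tens_ev f y) ->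
  x = y.
Proof.
move=> e; rewrite -[x]reprK -[y]reprK; apply/eqmodP/asboolP => V f; exact: e.
Qed.

Lemma tens_evE n V (f : balanced n V) (s : seq (tgen n)) :
  tens_ev f (tens_pi s) = tev f s.
Proof.
have : (\pi_(tens_car n) (tens_repr (tens_pi s) : {classic seq (tgen n)}) =
  \pi_(tens_car n) (s : {classic seq (tgen n)}))%qT by rewrite reprK.
by move=> /eqmodP /asboolP e; exact: e.
Qed.

Definition tgen_scale n (c : k) (g : tgen n) : tgen n :=
  let: Tgen _ _ h p x := g in Tgen h (c *: p) x.

Lemma tev_scale n V (f : balanced n V) c s :
  tev f (map (tgen_scale c) s) = c *: tev f s.
Proof.
rewrite /tev big_map scaler_sumr; apply: eq_bigr => -[i j h p x] _ /=.
have f0 : f i j h 0 x = 0.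
  by have := bal_linl f h x (-1) 0 0; rewrite scaler0 addr0 scaleN1r addNr.
by have := bal_linl f h x c p 0; rewrite /= addr0 f0 addr0.
Qed.

Definition tens_zero n : tens_car n := tens_pi [::].
Definition tens_add n (x y : tens_car n) : tens_car n :=
  tens_pi (tens_repr x ++ tens_repr y).
Definition tens_scale n (c : k) (x : tens_car n) : tens_car n :=
  tens_pi (map (tgen_scale c) (tens_repr x)).
Definition tens_opp n (x : tens_car n) : tens_car n := tens_scale (-1) x.

Lemma tens_ev0 n V (f : balanced n V) : tens_ev f (tens_zero n) = 0.
Proof. by rewrite tens_evE /tev big_nil. Qed.

Lemma tens_evD n V (f : balanced n V) x y :
  tens_ev f (tens_add x y) = tens_ev f x + tens_ev f y.
Proof. by rewrite tens_evE /tev big_cat. Qed.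

Lemma tens_evZ n V (f : balanced n V) c x :
  tens_ev f (tens_scale c x) = c *: tens_ev f x.
Proof. by rewrite tens_evE tev_scale. Qed.

Lemma tens_evN n V (f : balanced n V) x :
  tens_ev f (tens_opp x) = - tens_ev f x.
Proof. by rewrite tens_evZ scaleN1r. Qed.

Definition tens_evM := (tens_ev0, tens_evD, tens_evZ, tens_evN).

Lemma tens_addA n : associative (@tens_add n).
Proof. by move=> x y z; apply: tens_ext => V f; rewrite !tens_evM addrA. Qed.

Lemma tens_addC n : commutative (@tens_add n).
Proof. by move=> x y; apply: tens_ext => V f; rewrite !tens_evM addrC. Qed.

Lemma tens_add0 n : left_id (tens_zero n) (@tens_add n).
Proof. by move=> x; apply: tens_ext => V f; rewrite !tens_evM add0r. Qed.

Lemma tens_addN n : left_inverse (tens_zero n) (@tens_opp n) (@tens_add n).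
Proof. by move=> x; apply: tens_ext => V f; rewrite !tens_evM addNr. Qed.

HB.instance Definition _ n := GRing.isZmodule.Build (tens_car n)
  (@tens_addA n) (@tens_addC n) (@tens_add0 n) (@tens_addN n).

Lemma tens_scaleA n a b (x : tens_car n) :
  tens_scale a (tens_scale b x) = tens_scale (a * b) x.
Proof. by apply: tens_ext => V f; rewrite !tens_evM scalerA. Qed.

Lemma tens_scale1 n : left_id 1 (@tens_scale n).
Proof. by move=> x; apply: tens_ext => V f; rewrite !tens_evM scale1r. Qed.

Lemma tens_scaleDr n : right_distributive (@tens_scale n) +%R.
Proof. by move=> c x y; apply: tens_ext => V f; rewrite !tens_evM scalerDr. Qed.

Lemma tens_scaleDl n (x : tens_car n) :
  {morph (@tens_scale n)^~ x : a b / a + b}.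
Proof. by move=> a b; apply: tens_ext => V f; rewrite !tens_evM scalerDl. Qed.

HB.instance Definition _ n := GRing.Zmodule_isLmodule.Build k (tens_car n)
  (@tens_scaleA n) (@tens_scale1 n) (@tens_scaleDr n) (@tens_scaleDl n).

Lemma tens_ev_linear n V (f : balanced n V) : linear (tens_ev f).
Proof. by move=> a x y; rewrite [LHS]tens_evD tens_evZ. Qed.

HB.instance Definition _ n V (f : balanced n V) :=
  GRing.isLinear.Build k (tens_car n) V _ (tens_ev f) (tens_ev_linear f).

Lemma deg_dl (i j n n1 : int) : i + j = n -> n + 1 = n1 -> i + 1 + j = n1.
Proof. by move=> <- <-; rewrite addrAC. Qed.

Lemma deg_dr (i j n n1 : int) : i + j = n -> n + 1 = n1 -> i + (j + 1) = n1.
Proof. by move=> <- <-; rewrite addrA. Qed.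

(* d (p (x) m) = d p (x) m + (-1)^|p| p (x) d m                               *)
Definition tgen_d (n n1 : int) (hn : n + 1 = n1) (g : tgen n) :
    seq (tgen n1) :=
  let: Tgen i _ h p x := g in
  [:: Tgen (deg_dl h hn) (cx_d erefl p) x;
      Tgen (deg_dr h hn) p ((-1) ^ i *: cx_d erefl x)].

Definition tens_d (n n1 : int) (hn : n + 1 = n1) (x : tens_car n) :
    tens_car n1 :=
  tens_pi (flatten (map (tgen_d hn) (tens_repr x))).

Program Definition bal_d (n n1 : int) (hn : n + 1 = n1) (V : lmodType k)
    (f : balanced n1 V) : balanced n V :=
  @Balanced n V
    (fun i j h p x => f _ _ (deg_dl h hn) (cx_d erefl p) x
       + (-1) ^ i *: f _ _ (deg_dr h hn) p (cx_d erefl x)) _ _ _.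
Next Obligation.
move=> n n1 hn V f i j h p a x y; rewrite !linearP /= scalerDr.
exact: addrACA.
Qed.
Next Obligation.
move=> n n1 hn V f i j h x a p q; rewrite linearP !bal_linl !scalerDr.
by rewrite !scalerA [_ * a]mulrC addrACA.
Qed.
Next Obligation.
move=> n n1 hn V f a b c ab bc h1 h2 h3 h4 p r x.
have fD (i j : int) (h : i + j = n1) (u v : P i) (y : M j) (e : k) :
    f i j h (u + e *: v) y = f i j h u y + e *: f i j h v y.
  by rewrite addrC bal_linl addrC.
have hsgn : (-1 : k) ^ ab = (-1) ^ a * (-1) ^ b.
  by rewrite -h1 expfzDr ?oppr_eq0 ?oner_eq0.
rewrite (ract_leibniz h1 erefl erefl erefl (deg_dl h1 erefl) (deg_dr h1 erefl)).
rewrite (lact_leibniz h3 erefl erefl erefl (deg_dl h3 erefl) (deg_dr h3 erefl)).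
rewrite fD linearD linearZ /= scalerDr scalerA hsgn -!addrA.
have e1 : b + 1 + c = bc + 1 by exact: deg_dl h3 erefl.
have e2 : b + (c + 1) = bc + 1 by exact: deg_dr h3 erefl.
congr (_ + (_ *: _ + _ *: _)); exact: balA.
Qed.

Lemma tev_d n n1 (hn : n + 1 = n1) V (f : balanced n1 V) (s : seq (tgen n)) :
  tev f (flatten (map (tgen_d hn) s)) = tev (bal_d hn f) s.
Proof.
rewrite /tev big_flatten big_map; apply: eq_bigr => -[i j h p x] _ /=.
by rewrite big_cons big_seq1 /= linearZ.
Qed.

Lemma tens_evd n n1 (hn : n + 1 = n1) V (f : balanced n1 V) (x : tens_car n) :
  tens_ev f (tens_d hn x) = tens_ev (bal_d hn f) x.
Proof. by rewrite tens_evE tev_d. Qed.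

Program Definition tensor : complex k := @Complex k tens_car tens_d _ _.
Next Obligation.
move=> n n1 hn a x y; apply: tens_ext => V f.
by rewrite tens_evd [LHS]linearP [RHS]linearP /= !tens_evd.
Qed.
Next Obligation.
move=> n n1 n2 h h' x; apply: tens_ext => V f; rewrite !tens_evd raddf0.
rewrite /tens_ev /tev big1 // => -[i j hij p m] _ /=.
have f0 (i' j' : int) (e : i' + j' = n2) (y : M j') : f i' j' e 0 y = 0.
  by have := bal_linl f e y (-1) 0 0; rewrite scaler0 addr0 scaleN1r addNr.
rewrite !cx_dd f0 linear0 scaler0 addr0 add0r (sgnS _ (erefl (i + 1))).
rewrite scaleNr addrC; apply/eqP; rewrite subr_eq0; apply/eqP.
congr (_ *: f _ _ _ _ _); exact: eq_irrelevance.
Qed.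

End Tensor.

Arguments tensor {k R} P M.

(* The left derived functor of [tensor P], computed on a chosen K-projective  *)
(* resolution of [M].  Every DG module has one (Spaltenstein), so the [else]  *)
(* branch is never taken, and any two are homotopy equivalent, so the choice  *)
(* does not affect the result up to isomorphism.                              *)
Definition derived_tensor (k : fieldType) (R : dgAlgebra k)
    (P : dgRight R) (M : dgLeft R) : complex k :=
  if pselect (exists F : resolution M, True) is left e
  then tensor P (res_obj (projT1 (cid e))) else cx_zero k.

(* Main.v *)
From HB Require Import structures.
Require Import Defs.
From mathcomp Require Import all_boot all_order all_algebra.
From mathcomp Require Import boolp classical_sets functions constructive_ereal.
From mathcomp Require Import zify ring.

(** Let [F -> M] be a K-projective resolution.  The inequality holds because
    there are integers [b <= d], depending on [M] alone, such that for every
    right module [P] whose cohomology is non-zero in lowest degree [i] and in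
    highest degree [s], the lowest and highest degrees in which [P (x) F] has
    non-zero cohomology are [i + b] and [s + d].  Hence
    [amp (P (x) F) = amp P + (d - b)].

    The integers [b] and [d] are the lowest and the highest degree of a cell in
    a minimal semi-free resolution of [M].  They are found without building
    that resolution, by removing the bottom cells one degree at a time
    ([tensor_bounds_exist]).  If [a] is the lowest degree with [H^a(F) <> 0],
    a basis of [H^a(F)] gives a map to [F] from a direct sum [E] of copies of
    [R] placed in degree [a]; let [C] be its cone.  Since [R] vanishes in
    negative degrees and in degree 1, and is [k] in degree 0, the map is
    bijective on [H^a] and [H^(a+1)(E) = 0], so [H^j(C) = 0] for [j <= a]
    ([exact_cells_cone]).  The cohomology of [P (x) E] is a direct sum of copies
    of that of [P], moved by [a].  In the long exact sequence of
    [P (x) E -> P (x) F -> P (x) C], everything from [C] lies strictly above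
    the bottom class of [P (x) E], which therefore survives, and the top class
    of [P (x) C] lies above everything from [E], and therefore lifts.

    The process stops because [M] is compact.  A compact object admits a bound
    [D] such that every map from [F] to a module with no cohomology in degrees
    [<= D] is null-homotopic, and this passes to [C].  Once the cohomology of
    [F] itself starts above [D], the identity of [F] is null-homotopic.

    The bound, and the existence of [F], are established for all compact
    objects by induction on their construction
    ([compact_bounded_resolution]).  Two cases are not formal.  For an
    isomorphism [M ~ N] in the derived category, a formal zigzag from [M] to
    [N] is followed by lifting the single map [F -> M] along the
    quasi-isomorphisms that occur ([dmor_lift]); no resolution of the modules
    in between is used.  For a direct summand [M] of [T], an infinite sum of
    copies of [T] has an endomorphism with cokernel [M], so [M] is a cone of a
    map between modules that are already resolved ([quasi_iso_telescope]).

    The derived tensor product is computed on an arbitrary resolution, to which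
    the bound is carried over by comparing resolutions ([orth_transfer]). *)

Set Implicit Arguments.
Unset Strict Implicit.
Unset Printing Implicit Defensive.

Import Order.TTheory GRing.Theory Num.Theory.
Local Open Scope ring_scope.

(** * Abelian groups, signs and transport between equal degrees *)

(** Proves equalities that hold in every abelian group: everything is moved to
    one side, and each summand is cancelled against its opposite.  Every
    rewriting rule is instantiated at the type of the goal, because the modules
    here are indexed by integer sums, which must not be rewritten. *)
Ltac zmod_pull rule y :=
  first [rewrite rule | rewrite (addrCA _ y); zmod_pull rule y].

Ltac zmod_cancel :=
  repeat
    (lazymatch goal with
     | |- 0 = 0 => fail
     | |- - ?x + _ = 0 => zmod_pull (addKr x) x
     | |- ?x + _ = 0 => zmod_pull (addNKr x) (- x)
     end).

Ltac zmod :=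
  let T := match goal with |- @eq ?T _ _ => T end in
  let A := constr:(fun x y z : T => addrA x y z) in
  let N := constr:(fun x y : T => opprD x y) in
  let K := constr:(fun x : T => opprK x) in
  let Z := constr:(fun x : T => add0r x) in
  let Z' := constr:(fun x : T => addr0 x) in
  let O := constr:(@oppr0 _ : - (0 : T) = 0) in
  apply/eqP; rewrite -subr_eq0; apply/eqP; rewrite -[LHS]addr0;
  rewrite ?N ?K ?O ?Z ?Z'; rewrite ?N ?K; rewrite -[LHS]addr0 -?A; zmod_cancel;
  reflexivity.

Section Signs.
Variable k : fieldType.

Lemma sgnD (a b : int) : (-1 : k) ^ (a + b) = (-1) ^ a * (-1) ^ b.
Proof. by rewrite expfzDr ?oppr_eq0 ?oner_eq0. Qed.

Lemma sgn_parity (a b c : int) : a = b + c + c -> (-1 : k) ^ a = (-1) ^ b.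
Proof. by move=> ->; rewrite !sgnD -mulrA sgnK mulr1. Qed.

Lemma sgn_neg (a : int) : (-1 : k) ^ (- a) = (-1) ^ a.
Proof. by apply: (@sgn_parity _ _ (- a)); rewrite subrr add0r. Qed.

Lemma sgn_scaleK (V : lmodType k) (a : int) (x : V) :
  (-1) ^ a *: ((-1) ^ a *: x) = x.
Proof. by rewrite scalerA sgnK scale1r. Qed.

End Signs.

(** Homotopies are plain functions that come with a proof of linearity; these
    facts apply to them without a bundled structure. *)
Section LinearFunction.
Variables (k : fieldType) (U V : lmodType k) (f : U -> V).
Hypothesis lf : linear f.

Lemma lin0 : f 0 = 0.
Proof. by have := lf (-1) 0 0; rewrite !scaleN1r !addNr. Qed.
Lemma linZ c x : f (c *: x) = c *: f x.
Proof. by have := lf c x 0; rewrite lin0 !addr0. Qed.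
Lemma linD x y : f (x + y) = f x + f y.
Proof. by have := lf 1 x y; rewrite !scale1r. Qed.
Lemma linN x : f (- x) = - f x.
Proof. by rewrite -scaleN1r linZ scaleN1r. Qed.
Lemma linB x y : f (x - y) = f x - f y.
Proof. by rewrite linD linN. Qed.

End LinearFunction.

Section Transport.
Variable k : fieldType.
Implicit Types C : complex k.

Definition tr C (i j : int) (e : i = j) (x : C i) : C j := ecast a (C a) e x.

Lemma tr_id C i (e : i = i) (x : C i) : tr e x = x.
Proof. by rewrite (eq_irrelevance e erefl). Qed.

Lemma tr_linear C i j (e : i = j) : linear (@tr C i j e).
Proof. by case: j / e. Qed.

HB.instance Definition _ C i j (e : i = j) :=
  GRing.isLinear.Build k (C i) (C j) _ (@tr C i j e) (@tr_linear C i j e).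

Lemma tr_tr C i j l (e : i = j) (e' : j = l) (e'' : i = l) (x : C i) :
  tr e' (tr e x) = tr e'' x.
Proof. by case: l / e' e'' => e''; rewrite tr_id (eq_irrelevance e'' e). Qed.

Lemma d_tr C i j l (e : i = j) (h : j + 1 = l) (h' : i + 1 = l) (x : C i) :
  cx_d h (tr e x) = cx_d h' x.
Proof. by case: j / e h => h; rewrite tr_id (eq_irrelevance h h'). Qed.

Lemma tr_d C i j l (e : j = l) (h : i + 1 = j) (h' : i + 1 = l) (x : C i) :
  tr e (cx_d h x) = cx_d h' x.
Proof. by case: l / e h' => h'; rewrite tr_id (eq_irrelevance h h'). Qed.

Lemma act_tr (R : dgAlgebra k) (M : dgLeft R) a i j l (e : i = j)
    (h : a + j = l) (h' : a + i = l) (r : R a) (x : M i) :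
  lact h r (tr e x) = lact h' r x.
Proof. by case: j / e h => h; rewrite tr_id (eq_irrelevance h h'). Qed.

Lemma tr_act (R : dgAlgebra k) (M : dgLeft R) a i j l (e : j = l)
    (h : a + i = j) (h' : a + i = l) (r : R a) (x : M i) :
  tr e (lact h r x) = lact h' r x.
Proof. by case: l / e h' => h'; rewrite tr_id (eq_irrelevance h h'). Qed.

Lemma hom_tr (R : dgAlgebra k) (M N : dgLeft R) (f : dgHom M N) i j
    (e : i = j) (x : M i) :
  f j (tr e x) = tr e (f i x).
Proof. by case: j / e. Qed.

Lemma act_linear_l (R : dgAlgebra k) (M : dgLeft R) a i j (h : a + i = j)
    (c : k) (r s : R a) (x : M i) :
  lact h (c *: r + s) x = c *: lact h r x + lact h s x.
Proof. exact: (lact_linl h x c r s). Qed.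

Lemma actZl (R : dgAlgebra k) (M : dgLeft R) a i j (h : a + i = j)
    (c : k) (r : R a) (x : M i) : lact h (c *: r) x = c *: lact h r x.
Proof.
exact: (linZ (lact_linl h x)).
Qed.

End Transport.

(** * Complexes and short exact sequences *)

Section Exactness.
Variable k : fieldType.
Implicit Types C G B : complex k.

Definition exact_at C (n : int) : Prop :=
  forall x : C n, cocycle x -> coboundary x.

Lemma exact_atP C n : ~ H_nonzero C n <-> exact_at C n.
Proof.
split=> [nH x zx|ex [x [zx]]]; last by case; apply: ex.
by apply: contrapT => nb; apply: nH; exists x.
Qed.

Lemma H_nonzeroP C n : H_nonzero C n <-> ~ exact_at C n.
Proof.
split=> [h /exact_atP|h]; first by [].
by apply: contrapT => /exact_atP.
Qed.

Lemma cocycleE C i j (h : i + 1 = j) (x : C i) :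
  cocycle x <-> cx_d h x = 0.
Proof.
split=> [zx|e l h']; first exact: zx.
by case: l / h' => //; case: j / h e => e; rewrite e.
Qed.

Lemma coboundaryE C i j (h : i + 1 = j) (x : C j) :
  coboundary x <-> exists y : C i, cx_d h y = x.
Proof.
split=> [[i' [h' [y <-]]]|[y e]]; last by exists i, h, y.
have e : i' = i by apply: (addIr 1); rewrite h h'.
by case: i / e h => h; exists y; rewrite (eq_irrelevance h h').
Qed.

Lemma cocycle0 C n : cocycle (0 : C n).
Proof. by move=> l h; rewrite linear0. Qed.

Lemma cocycleB C n (x y : C n) : cocycle x -> cocycle y -> cocycle (x - y).
Proof. by move=> zx zy l h; rewrite linearB /= zx zy subr0. Qed.

Lemma coboundary_d C i j (h : i + 1 = j) (x : C i) : coboundary (cx_d h x).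
Proof. by exists i, h, x. Qed.

Lemma coboundary_lin C n (c : k) (x y : C n) :
  coboundary x -> coboundary y -> coboundary (c *: x + y).
Proof.
move=> [i [h [x' <-]]] /(coboundaryE h) [y' <-].
by exists i, h, (c *: x' + y'); rewrite linearP.
Qed.

Lemma coboundary0 C n : coboundary (0 : C n).
Proof.
by exists (n - 1), (subrK 1 n), 0; rewrite linear0.
Qed.

Lemma coboundaryD C n (x y : C n) :
  coboundary x -> coboundary y -> coboundary (x + y).
Proof. by move=> bx by_; rewrite -[x]scale1r; apply: coboundary_lin. Qed.

Lemma coboundaryZ C n c (x : C n) : coboundary x -> coboundary (c *: x).
Proof.
by move=> bx; rewrite -[_ *: _]addr0; apply: coboundary_lin => //;
  apply: coboundary0.
Qed.

Lemma coboundaryN C n (x : C n) : coboundary x -> coboundary (- x).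
Proof. by rewrite -scaleN1r; apply: coboundaryZ. Qed.

Lemma coboundaryB C n (x y : C n) :
  coboundary x -> coboundary y -> coboundary (x - y).
Proof. by move=> bx /coboundaryN; apply: coboundaryD. Qed.

Section ShortExactSequence.
Variables (G C B : complex k).
Variables (f : forall n, {linear G n -> C n}) (q : forall n, {linear C n -> B n}).
Hypothesis f_d : forall n m (h : n + 1 = m) x, f m (cx_d h x) = cx_d h (f n x).
Hypothesis q_d : forall n m (h : n + 1 = m) x, q m (cx_d h x) = cx_d h (q n x).
Hypothesis f_inj : forall n x, f n x = 0 -> x = 0.
Hypothesis q_surj : forall n y, exists x, q n x = y.
Hypothesis qf : forall n x, q n (f n x) = 0.
Hypothesis exact_mid : forall n z, q n z = 0 -> exists x, f n x = z.

(** In the long exact sequence of [0 -> G -> C -> B -> 0], a term between two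
    zero terms is zero; the three lemmas are the three positions. *)
Lemma ses_mid n : exact_at G n -> exact_at B n -> exact_at C n.
Proof.
move=> eG eB z zz; have h := subrK 1 n.
have /eB /(coboundaryE h) [b eb] : cocycle (q n z).
  by move=> l hl; rewrite -q_d zz linear0.
have [w ew] := q_surj b.
have [|x ex] := @exact_mid n (z - cx_d h w).
  by rewrite linearB /= q_d ew eb subrr.
have /eG /(coboundaryE h) [g eg] : cocycle x.
  by move=> l hl; apply: f_inj; rewrite f_d ex linearB /= zz cx_dd subr0.
apply/(coboundaryE h); exists (w + f _ g).
by rewrite linearD /= -f_d eg ex addrC subrK.
Qed.

Lemma ses_left m n (h : m + 1 = n) :
  exact_at B m -> exact_at C n -> exact_at G n.
Proof.
move=> eB eC x zx.
have /eC /(coboundaryE h) [z ez] : cocycle (f n x).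
  by move=> l hl; rewrite -f_d zx linear0.
have h' := subrK 1 m.
have /eB /(coboundaryE h') [b eb] : cocycle (q m z).
  by apply/(cocycleE h); rewrite -q_d ez qf.
have [w ew] := q_surj b.
have [|g eg] := @exact_mid m (z - cx_d h' w).
  by rewrite linearB /= q_d ew eb subrr.
apply/(coboundaryE h); exists g; apply/eqP; rewrite -subr_eq0; apply/eqP.
by apply: f_inj; rewrite linearB /= f_d eg linearB /= cx_dd subr0 ez subrr.
Qed.

Lemma ses_right m n (h : m + 1 = n) :
  exact_at C m -> exact_at G n -> exact_at B m.
Proof.
move=> eC eG b zb; have [z ez] := q_surj b.
have [|x ex] := @exact_mid n (cx_d h z); first by rewrite q_d ez zb.
have /eG /(coboundaryE h) [g eg] : cocycle x.
  by move=> l hl; apply: f_inj; rewrite f_d ex cx_dd.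
have /eC [i [h' [w ew]]] : cocycle (z - f m g).
  by apply/(cocycleE h); rewrite linearB /= -f_d eg ex subrr.
exists i, h', (q i w); rewrite -q_d ew linearB /= qf subr0; exact: ez.
Qed.

End ShortExactSequence.

Lemma exact_at_shift C n m (h : n + 1 = m) :
  exact_at (cx_shift C) n <-> exact_at C m.
Proof.
case: m / h; split=> ex x zx.
  have [|i [h [y ey]]] := ex x.
    by move=> l h /=; rewrite zx oppr0.
  exists (i + 1), (degS2 h), (- y); rewrite linearN; exact: ey.
have [|i [h [y ey]]] := ex x.
  by apply/(cocycleE (erefl (n + 1 + 1))); have := zx _ erefl => /eqP /=;
     rewrite oppr_eq0 => /eqP; rewrite (eq_irrelevance (degS2 _) erefl).
have e : i = n - 1 + 1 by rewrite subrK; apply: (addIr 1).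
case: _ / (esym e) y h ey => y h ey.
exists (n - 1), (subrK 1 n), (- y); rewrite /= linearN opprK.
by rewrite (eq_irrelevance (degS2 _) h).
Qed.

End Exactness.

(** * Homotopies *)

Section Homotopy.
Variables (k : fieldType) (R : dgAlgebra k).
Implicit Types L M N : dgLeft R.

Lemma hom_cocycle M N (f : dgHom M N) i (x : M i) :
  cocycle x -> cocycle (f i x).
Proof. by move=> zx l h; rewrite -dgh_d zx linear0. Qed.

Lemma hom_coboundary M N (f : dgHom M N) i (x : M i) :
  coboundary x -> coboundary (f i x).
Proof. by move=> [j [h [y <-]]]; exists j, h, (f j y); rewrite -dgh_d. Qed.

#[local] Obligation Tactic := idtac.
Program Definition dg_sub M N (f g : dgHom M N) : dgHom M N :=
  @DGHom k R M N (fun i x => f i x - g i x) _ _ _.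
Next Obligation.
by move=> M N f g i a x y; rewrite (dgh_lin f) (dgh_lin g) scalerBr opprD addrACA.
Qed.
Next Obligation. by move=> M N f g i j h x; rewrite linearB !dgh_d. Qed.
Next Obligation. by move=> M N f g i j n h r x; rewrite linearB !dgh_act. Qed.

Program Definition dg_null M N : dgHom M N := @DGHom k R M N (fun _ _ => 0) _ _ _.
Next Obligation. by move=> M N i a x y; rewrite scaler0 addr0. Qed.
Next Obligation. by move=> M N i j h x; rewrite linear0. Qed.
Next Obligation. by move=> M N i j n h r x; rewrite linear0. Qed.

Definition homotopic M N (f g : dgHom M N) : Prop := null_homotopic (dg_sub f g).

Lemma null_ext M N (f g : dgHom M N) :
  (forall i x, f i x = g i x) -> null_homotopic f -> null_homotopic g.
Proof. by move=> e [s [s1 s2 s3]]; exists s; split=> // *; rewrite -e; apply: s3. Qed.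

Lemma null_sub M N (f g : dgHom M N) :
  null_homotopic f -> null_homotopic g -> null_homotopic (dg_sub f g).
Proof.
move=> [s [s1 s2 s3]] [t [t1 t2 t3]].
exists (fun i j h x => s i j h x - t i j h x); split=> /=.
- by move=> i j h a x y; rewrite s1 t1 /= scalerBr opprD addrACA.
- by move=> a i j n l hi h hn hj r x; rewrite (s2 _ _ _ _ _ _ h _ hj)
    (t2 _ _ _ _ _ _ h _ hj) linearB scalerBr.
- by move=> i j l h h' x; rewrite (s3 _ _ _ h h') (t3 _ _ _ h h') [cx_d h (_ - _)]linearB
    opprD addrACA.
Qed.

Lemma null_zero M N : null_homotopic (dg_null M N).
Proof.
exists (fun _ _ _ _ => 0); split=> *; rewrite ?linear0 ?scaler0 ?addr0 //.
by move=> a x y; rewrite scaler0 addr0.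
Qed.

Lemma null_compl L M N (g : dgHom M N) (f : dgHom L M) :
  null_homotopic f -> null_homotopic (dg_comp g f).
Proof.
move=> [s [s1 s2 s3]]; exists (fun i j h x => g j (s i j h x)); split=> /=.
- by move=> i j h a x y; rewrite s1 linearP.
- by move=> a i j n l hi h hn hj r x; rewrite (s2 _ _ _ _ _ _ h _ hj) linearZ
    /= dgh_act.
- by move=> i j l h h' x; rewrite (s3 _ _ _ h h') linearD /= dgh_d.
Qed.

Lemma null_compr L M N (g : dgHom M N) (f : dgHom L M) :
  null_homotopic g -> null_homotopic (dg_comp g f).
Proof.
move=> [s [s1 s2 s3]]; exists (fun i j h x => s i j h (f i x)); split=> /=.
- by move=> i j h a x y; rewrite linearP s1.
- by move=> a i j n l hi h hn hj r x; rewrite dgh_act (s2 _ _ _ _ _ _ h _ hj).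
- by move=> i j l h h' x; rewrite (s3 _ _ _ h h') dgh_d.
Qed.

Lemma null_coboundary M N (f : dgHom M N) i (x : M i) :
  null_homotopic f -> cocycle x -> coboundary (f i x).
Proof.
move=> [s [s1 _ s3]] zx.
have e := s3 i (i - 1) (i + 1) (subrK 1 i) erefl x.
rewrite e (zx _ erefl) (lin0 (s1 _ _ _)) addr0; exact: coboundary_d.
Qed.

End Homotopy.

(** * Shifts and left orthogonality *)

(** The shift by an arbitrary integer serves both to desuspend and to place a
    copy of [R] in a given degree. *)
Section Shift.
Variables (k : fieldType) (a : int).

Lemma sh_deg_d (i j : int) : i + 1 = j -> i + a + 1 = j + a.
Proof. by move=> <-; rewrite addrAC. Qed.

Lemma sh_deg (i j n : int) : i + j = n -> i + (j + a) = n + a.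
Proof. by move=> <-; rewrite addrA. Qed.

#[local] Obligation Tactic := idtac.
Program Definition cx_sh (C : complex k) : complex k :=
  @Complex k (fun i => C (i + a)) (fun _ _ h x => (-1) ^ a *: cx_d (sh_deg_d h) x)
    _ _.
Next Obligation.
by move=> C i j h c x y; rewrite linearP scalerDr !scalerA mulrC.
Qed.
Next Obligation.
by move=> C i j l h h' x; rewrite /= linearZ /= cx_dd !scaler0.
Qed.

Variable R : dgAlgebra k.
Program Definition dg_sh (M : dgLeft R) : dgLeft R :=
  @DGLeft k R (cx_sh M)
    (fun i _ _ h r x => (-1) ^ (a * i) *: lact (sh_deg h) r x) _ _ _ _ _.
Next Obligation.
by move=> M i j n h r c x y; rewrite linearP scalerDr !scalerA [_ * c]mulrC.
Qed.
Next Obligation.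
by move=> M i j n h x c r s; rewrite act_linear_l scalerDr !scalerA [_ * c]mulrC.
Qed.
Next Obligation.
move=> M b1 b2 b3 b12 b23 n h1 h2 h3 h4 r s x /=.
by rewrite linearZ /= (lactA h1 (sh_deg h2)) scalerA -sgnD -mulrDr;
  congr ((-1) ^ (a * _) *: _).
Qed.
Next Obligation. by move=> M i h x; rewrite /= lact1 mulr0 expr0z scale1r. Qed.
Next Obligation.
move=> M i j n i1 j1 n1 h hn hi hj h1 h2 r x /=.
rewrite [in LHS]linearZ /=.
rewrite (lact_leibniz (sh_deg h) _ hi (sh_deg_d hj) (sh_deg h1) (sh_deg h2)).
rewrite [lact (sh_deg h2) r (_ *: _)]linearZ /= !scalerDr !scalerA -!sgnD.
congr (_ ^ _ *: _ + _ ^ _ *: _); first by rewrite -hi mulrDr mulr1 addrC.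
by ring.
Qed.

Lemma exact_at_sh (C : complex k) n m : n + a = m ->
  exact_at (cx_sh C) n <-> exact_at C m.
Proof.
move=> <-; split=> ex x zx.
  have [|i [h [y ey]]] := ex x.
    by move=> l h /=; rewrite zx scaler0.
  by exists (i + a), (sh_deg_d h), ((-1) ^ a *: y); rewrite linearZ.
have h := subrK 1 n.
have [|i [h' [y ey]]] := ex x.
  apply/(cocycleE (sh_deg_d (erefl (n + 1)))).
  by have /(congr1 (fun z => (-1) ^ a *: z)) := zx _ erefl;
     rewrite /= sgn_scaleK scaler0.
have e : i = n - 1 + a by apply: (addIr 1); rewrite h' -addrA [a + 1]addrC addrA h.
case: _ / (esym e) y h' ey => y h' ey.
exists (n - 1), h, ((-1) ^ a *: y); rewrite /= linearZ /= sgn_scaleK -ey.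
by rewrite (eq_irrelevance (sh_deg_d h) h').
Qed.

Program Definition dg_sh_map (M N : dgLeft R) (f : dgHom M N) :
    dgHom (dg_sh M) (dg_sh N) :=
  @DGHom k R (dg_sh M) (dg_sh N) (fun i => f (i + a)) _ _ _.
Next Obligation. by move=> M N f i c x y; exact (dgh_lin f c x y). Qed.
Next Obligation. by move=> M N f i j h x /=; rewrite linearZ /= dgh_d. Qed.
Next Obligation. by move=> M N f i j n h r x /=; rewrite linearZ /= dgh_act. Qed.

Lemma tr_sh (C : complex k) i j (e : i = j) (e' : i + a = j + a)
    (x : C (i + a)) : tr e (x : cx_sh C i) = tr e' x.
Proof. by case: j / e e' => e'; rewrite !tr_id. Qed.

Lemma cocycle_sh (C : complex k) i (x : C (i + a)) :
  cocycle (x : cx_sh C i) <-> cocycle x.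
Proof.
split=> zx; last by move=> l h /=; rewrite zx scaler0.
apply/(cocycleE (sh_deg_d (erefl (i + 1)))).
by have /(congr1 (fun z => (-1) ^ a *: z)) := zx _ erefl;
   rewrite /= sgn_scaleK scaler0.
Qed.

Lemma coboundary_sh (C : complex k) i (x : C (i + a)) :
  coboundary (x : cx_sh C i) <-> coboundary x.
Proof.
have h := subrK 1 i; rewrite (coboundaryE h) (coboundaryE (sh_deg_d h)).
split=> -[y <-]; exists ((-1) ^ a *: y); first by rewrite linearZ.
by rewrite /= linearZ /= sgn_scaleK.
Qed.

Lemma quasi_iso_sh (M N : dgLeft R) (f : dgHom M N) :
  quasi_iso f -> quasi_iso (dg_sh_map f).
Proof.
move=> qf i; have [inj surj] := qf (i + a); split=> [x|y].
  by move=> /cocycle_sh zx /coboundary_sh bx; apply/coboundary_sh/inj.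
move=> /cocycle_sh /surj [x [zx bx]]; exists x.
by split; [apply/cocycle_sh|apply/coboundary_sh].
Qed.

End Shift.

Section Orthogonality.
Variables (k : fieldType) (R : dgAlgebra k).
Implicit Types (F M N : dgLeft R) (S : int -> Prop).

(** [F] is left orthogonal to the modules without cohomology in the degrees of
    [S].  With all degrees this is K-projectivity; with the degrees [<= D] it
    bounds the degrees of the cells of [F] by [D]. *)
Definition orth S F : Prop := forall N (f : dgHom F N),
  (forall j, S j -> exact_at N j) -> null_homotopic f.

Lemma orth_sub S S' F : (forall j, S j -> S' j) -> orth S F -> orth S' F.
Proof. by move=> sub oF N f eN; apply: oF => j /sub /eN. Qed.

Lemma K_projectiveP F : K_projective F <-> orth (fun _ => True) F.
Proof.
split=> kF N f aN; first by apply: kF => j; apply/exact_atP/aN.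
by apply: kF => j _; apply/exact_atP/aN.
Qed.

(** A map [f] out of [F] is homotopic to [f h g], and [f h] starts from [G]. *)
Lemma orth_retract S F G (g : dgHom F G) (h : dgHom G F) :
  homotopic (dg_comp h g) (dg_id F) -> orth S G -> orth S F.
Proof.
move=> hg oG N f eN.
have n1 := null_compl f hg.
have n2 := null_compr g (oG _ (dg_comp f h) eN).
apply: null_ext (null_sub n2 n1) => i x /=.
by rewrite linearB /= subKr.
Qed.

(** Maps from a shift of [F] to [N] are maps from [F] to the inverse shift of
    [N].  The homotopy that comes back lands in degree [j + a - a], which is
    equal but not convertible to [j]. *)
Lemma orth_sh (a : int) S F :
  orth S F -> orth (fun j => S (j + a)) (dg_sh a F).
Proof.
move=> oF N f eN.
pose e1 i : i = i - a + a := esym (subrK a i).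
have fl i : linear (fun x : F i => f (i - a) (tr (e1 i) x) : dg_sh (- a) N i).
  by move=> c x y; rewrite !linearP.
have fd (i j : int) (h : i + 1 = j) (x : F i) :
    (f (j - a) (tr (e1 j) (cx_d h x)) : dg_sh (- a) N j)
     = cx_d h (f (i - a) (tr (e1 i) x) : dg_sh (- a) N i).
  rewrite /= -dgh_d /= sgn_neg -linearZ /= sgn_scaleK; congr (f _ _).
  rewrite (tr_d _ _ (etrans h (e1 j))).
  by rewrite (d_tr _ _ (etrans h (e1 j))).
have fa (i j n : int) (h : i + j = n) (r : R i) (x : F j) :
    (f (n - a) (tr (e1 n) (lact h r x)) : dg_sh (- a) N n)
     = lact h r (f (j - a) (tr (e1 j) x) : dg_sh (- a) N j).
  rewrite /= -dgh_act /= mulNr sgn_neg -linearZ /= sgn_scaleK; congr (f _ _).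
  rewrite (tr_act _ _ (etrans h (e1 n))).
  by rewrite (act_tr _ _ (etrans h (e1 n))).
have [|s [s1 s2 s3]] := oF _ (DGHom fl fd fa).
  by move=> j Sj; apply/(exact_at_sh _ (erefl (j - a)))/eN; rewrite subrK.
pose e2 j : j + a - a = j := addrK a j.
exists (fun i j h x => (-1) ^ a *: tr (e2 j) (s (i + a) (j + a) (sh_deg_d a h) x)).
split.
- move=> i j h c x y; rewrite s1 linearP scalerDr !scalerA.
  by rewrite [_ * c]mulrC.
- move=> b i j n l hi h hn hj r x /=.
  rewrite (linZ (s1 _ _ _)) (s2 b (i + a) (j + a) (n + a) (l + a) (sh_deg a hi)
    (sh_deg_d a h) (sh_deg_d a hn) (sh_deg a hj)) /=.
  rewrite mulNr sgn_neg [_ *: ((-1) ^ b *: _)]scalerA mulrC -scalerA sgn_scaleK.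
  rewrite !linearZ /= scalerA mulrC -scalerA; congr (_ *: (_ *: _)).
  have hj' : b + (j + a - a) = l by rewrite e2.
  by rewrite (tr_act _ _ hj') (act_tr _ _ hj').
- move=> i j l h h' x.
  have := s3 (i + a) (j + a) (l + a) (sh_deg_d a h) (sh_deg_d a h') x.
  move=> /(congr1 (@tr _ N _ _ (e2 i))) /=.
  rewrite -hom_tr (tr_sh _ (congr1 (+%R^~ a) (e2 i))).
  rewrite (tr_tr _ _ (erefl (i + a))) tr_id => ->.
  rewrite linearD /= sgn_neg; congr (_ + _).
    have h2 : j + a - a + 1 = i by rewrite e2.
    by rewrite !linearZ /= (tr_d _ _ h2) (d_tr _ _ h2).
  by rewrite (linZ (s1 _ _ _)) linearZ /= sgn_scaleK.
Qed.

End Orthogonality.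

(** * Cones *)

Section Cone.
Variables (k : fieldType) (R : dgAlgebra k).
Implicit Types (F M N : dgLeft R) (S : int -> Prop).

#[local] Obligation Tactic := idtac.
Program Definition cone_in M N (f : dgHom M N) : dgHom N (dg_cone f) :=
  @DGHom k R N (dg_cone f) (fun i y => (y, 0)) _ _ _.
Next Obligation.
by move=> M N f i c x y; congr pair; rewrite /= ?scaler0 ?addr0.
Qed.
Next Obligation.
by move=> M N f i j h x; case: j / h; rewrite /= !linear0 ?oppr0 addr0.
Qed.
Next Obligation.
by move=> M N f i j n h r x; congr pair; rewrite /= linear0 scaler0.
Qed.

Lemma cone_dE M N (f : dgHom M N) i (y : N i) (x : M (i + 1)) :
  cx_d (erefl (i + 1)) ((y, x) : dg_cone f i) =
  (cx_d erefl y + f _ x, - cx_d erefl x).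
Proof. by rewrite /= (eq_irrelevance (degS2 _) erefl). Qed.

Lemma cone_coboundary M N (f : dgHom M N) i j (h : i + 1 = j)
    (y : N i) (x : M j) (z : dg_cone f j) :
  z.1 = cx_d h y + f j x -> z.2 = - cx_d erefl x -> coboundary z.
Proof.
case: j / h x z => x [z1 z2] /= -> ->; exists i, erefl, (y, x).
by rewrite cone_dE.
Qed.

Lemma cone_cocycle M N (f : dgHom M N) i (z : dg_cone f i) :
  cocycle z <-> cx_d erefl z.1 + f _ z.2 = 0 /\ cocycle z.2.
Proof.
case: z => y x; rewrite (cocycleE (erefl (i + 1))) cone_dE /=; split=> [[-> e]|].
  by split=> //; apply/(cocycleE erefl); apply/eqP; rewrite -oppr_eq0; apply/eqP.
by move=> [-> ->]; rewrite oppr0.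
Qed.

Lemma quasi_iso_cone M N (f : dgHom M N) j :
  quasi_iso f -> exact_at (dg_cone f) j.
Proof.
move=> qf [y x] /cone_cocycle /= [e zx].
have h := subrK 1 j.
have /(coboundaryE (erefl (j + 1))) [x1 ex1] : coboundary x.
  apply: (qf _).1 => //; apply/(coboundaryE erefl); exists (- y).
  by rewrite linearN /=; have /eqP := e; rewrite addr_eq0 => /eqP ->; rewrite opprK.
have [|x2 [zx2 /(coboundaryE h) [w ew]]] := (qf j).2 (y + f j x1).
  by apply/(cocycleE erefl); rewrite linearD /= -dgh_d ex1.
apply: (@cone_coboundary _ _ _ _ _ h (- w) (x2 - x1)) => /=.
  by rewrite linearN linearB /= ew opprB addrA subrK addrK.
by rewrite linearB /= zx2 sub0r opprK ex1.
Qed.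

(** If [g] restricted to [N] is null-homotopic by [s], then [g - s f], on the
    other component, is a homomorphism from the suspension of [M]. *)
Lemma orth_cone S M N (f : dgHom M N) :
  orth S N -> orth S (dg_sh 1 M) -> orth S (dg_cone f).
Proof.
move=> oN oM L g eL.
have [s [s1 s2 s3]] := oN _ (dg_comp g (cone_in f)) eL.
have g_split i (y : N i) (x : M (i + 1)) : g i (y, x) = g i (y, 0) + g i (0, x).
  by rewrite -linearD /=; congr (g i (_, _)); rewrite ?addr0 ?add0r.
pose u i (x : dg_sh 1 M i) : L i := g i (0, x) - s (i + 1) i erefl (f (i + 1) x).
have ul i : linear (@u i).
  move=> c x y; rewrite /u linearP s1 scalerBr opprD addrACA; congr (_ + _).
  by rewrite -linearP; congr (g i (_, _)); rewrite /= ?scaler0 ?addr0.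
have ud (i j : int) (h : i + 1 = j) (x : dg_sh 1 M i) :
    u j (cx_d h x) = cx_d h (u i x).
  case: j / h; rewrite /u linearB /= -(dgh_d g) cone_dE linear0 add0r.
  rewrite (eq_irrelevance (sh_deg_d 1 erefl) erefl) expr1z !scaleN1r.
  rewrite (g_split _ (f _ x)).
  have /= -> := s3 (i + 1) i _ erefl erefl (f _ x).
  by rewrite linearN /= (linN (s1 _ _ _)) dgh_d; zmod.
have ua (i j n : int) (h : i + j = n) (r : R i) (x : dg_sh 1 M j) :
    u n (lact h r x) = lact h r (u j x).
  rewrite /u linearB /= -(dgh_act g) /= linear0 mul1r.
  rewrite (eq_irrelevance (sh_deg 1 h) (degS h)) linearZ /= (linZ (s1 _ _ _)) dgh_act.
  by rewrite (s2 _ _ _ _ _ _ erefl _ h) sgn_scaleK.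
have [t [t1 t2 t3]] := oM _ (DGHom ul ud ua) eL.
exists (fun i j h z => s i j h z.1 + t i j h z.2); split.
- by move=> i j h c x y; rewrite /= s1 t1 scalerDr addrACA.
- move=> b i j n l hi h hn hj r [y x] /=.
  rewrite (s2 _ _ _ _ _ _ h _ hj) linearD scalerDr; congr (_ + _).
  have := t2 b i j n l hi h hn hj r x; rewrite /= mul1r => <-.
  by rewrite (eq_irrelevance (sh_deg 1 hi) (degS hi)).
- move=> i j l h h' [y x]; case: l / h' => /=.
  rewrite g_split (s3 i j _ h erefl y : g i (y, 0) = _).
  have /= := t3 i j _ h erefl x; rewrite /u.
  move=> /eqP; rewrite subr_eq => /eqP ->.
  rewrite (eq_irrelevance (sh_deg_d 1 erefl) erefl).
  rewrite (eq_irrelevance (degS2 erefl) erefl) expr1z scaleN1r.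
  by rewrite linearD /= (linD (s1 _ _ _)); zmod.
Qed.

(** The composite of [f] with the inclusion of [N] into the acyclic cone of [s]
    is null-homotopic.  The two components of the null-homotopy are a homotopy
    and the lift. *)
Lemma lift_quasi_iso F M N (s : dgHom M N) (f : dgHom F N) :
  orth (fun _ => True) F -> quasi_iso s ->
  exists g : dgHom F M, homotopic (dg_comp s g) f.
Proof.
move=> oF qs.
have [|t [t1 t2 t3]] := oF _ (dg_comp (cone_in s) f).
  by move=> j _; apply: quasi_iso_cone.
pose g i (x : F i) : M i := tr (subrK 1 i) (t i (i - 1) (subrK 1 i) x).2.
have gE i j (h : j + 1 = i) x : g i x = tr h (t i j h x).2.
  have e : i - 1 = j by rewrite -h addrK.
  by case: j / e h => h; rewrite (eq_irrelevance h (subrK 1 i)).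
have [gl tl] : (forall i, linear (@g i)) /\ forall i j h, linear (fun x => (t i j h x).1).
  split=> [i|i j h] c x y; last by rewrite t1.
  by rewrite /g t1 /= linearP.
have eqn l i (h : l + 1 = i) (x : F l) :
    f l x = cx_d (subrK 1 l) (t l (l - 1) (subrK 1 l) x).1 + s l (g l x)
            + (t i l h (cx_d h x)).1 /\
    (t i l h (cx_d h x)).2 = cx_d (degS2 (subrK 1 l)) (t l (l - 1) (subrK 1 l) x).2.
  have /= [-> e2] := t3 l (l - 1) i (subrK 1 l) h x; split=> //.
  by have /esym/eqP := e2; rewrite addr_eq0 eqr_opp => /eqP <-.
have gd (i j : int) (h : i + 1 = j) (x : F i) : g j (cx_d h x) = cx_d h (g i x).
  rewrite (gE j i h) (eqn i j h x).2 (tr_d _ _ (etrans (degS2 (subrK 1 i)) h)).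
  by rewrite (d_tr _ _ (etrans (degS2 (subrK 1 i)) h)).
have ga (i j n : int) (h : i + j = n) (r : R i) (x : F j) :
    g n (lact h r x) = lact h r (g j x).
  have hj : i + (j - 1) = n - 1 by rewrite addrA h.
  rewrite /g (t2 i j (j - 1) n (n - 1) h (subrK 1 j) (subrK 1 n) hj) /= sgn_scaleK.
  have h' : i + (j - 1 + 1) = n by rewrite subrK.
  by rewrite (tr_act _ _ h') (act_tr _ _ h').
exists (DGHom gl gd ga), (fun i j h x => - (t i j h x).1); split=> /=.
- by move=> i j h c x y; rewrite t1 /= scalerN opprD.
- by move=> b i j n l hi h hn hj r x; rewrite (t2 _ _ _ _ _ _ h _ hj) /=
    linearN scalerN.
- move=> i j l h h' x; have e : i - 1 = j by rewrite -h addrK.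
  case: j / e h => h; rewrite (eqn i l h' x).1 linearN /=.
  by rewrite (eq_irrelevance h (subrK 1 i)); zmod.
Qed.

(** In a contraction of the cone, the component from [N] to [M] is a
    homomorphism, and the component from [M] to [M] is the homotopy. *)
Lemma cone_contractible M N (f : dgHom M N) :
  null_homotopic (dg_id (dg_cone f)) ->
  exists h : dgHom N M, homotopic (dg_comp h f) (dg_id M).
Proof.
move=> [t [t1 t2 t3]].
pose q i (z : dg_cone f i) : M (i + 1) := z.2.
have ql i j h : linear (fun z => q j (t i j h z)) by move=> c x y; rewrite t1.
pose g i (y : N i) : M i := tr (subrK 1 i) (q _ (t i (i - 1) (subrK 1 i) (y, 0))).
have gE i j (h : j + 1 = i) y : g i y = tr h (q _ (t i j h (y, 0))).
  have e : i - 1 = j by rewrite -h addrK.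
  by case: j / e h => h; rewrite (eq_irrelevance h (subrK 1 i)).
pose s i j (h : j + 1 = i) (x : M i) : M j :=
  tr (subrK 1 j) (q _ (t j (j - 1) (subrK 1 j) (0, tr (esym h) x))).
have sE i j l (h : j + 1 = i) (h' : l + 1 = j) x :
    s i j h x = tr h' (q _ (t j l h' (0, tr (esym h) x))).
  have e : j - 1 = l by rewrite -h' addrK.
  by case: l / e h' => h'; rewrite (eq_irrelevance h' (subrK 1 j)).
have t_eqn i (z : dg_cone f i) : q i z =
   - cx_d (degS2 (subrK 1 i)) (q _ (t i (i - 1) (subrK 1 i) z))
   + q i (t (i + 1) i erefl (cx_d erefl z)).
  by have /= := t3 i (i - 1) _ (subrK 1 i) erefl z; move/(congr1 (q i)).
have gl i : linear (@g i).
  move=> c x y; rewrite /g -linearP -ql; congr (tr _ (q _ (t _ _ _ (_, _)))).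
  by rewrite /= scaler0 addr0.
have gd (i j : int) (h : i + 1 = j) (y : N i) : g j (cx_d h y) = cx_d h (g i y).
  case: j / h; rewrite (gE _ i erefl) tr_id.
  have := t_eqn i (y, 0); rewrite cone_dE !linear0 ?oppr0 addr0 /=.
  move=> /esym/eqP; rewrite addr_eq0 eqr_opp => /eqP <-.
  by rewrite (d_tr _ _ (degS2 (subrK 1 i))).
have ga (i j n : int) (h : i + j = n) (r : R i) (y : N j) :
    g n (lact h r y) = lact h r (g j y).
  have hj : i + (j - 1) = n - 1 by rewrite addrA h.
  have h' : i + (j - 1 + 1) = n by rewrite subrK.
  have := t2 i j (j - 1) n (n - 1) h (subrK 1 j) (subrK 1 n) hj r (y, 0).
  rewrite /= linear0 scaler0 /g => -> /=; rewrite sgn_scaleK.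
  by rewrite (tr_act _ _ h') (act_tr _ _ h').
exists (DGHom gl gd ga), s; split.
- move=> i j h c x y; rewrite /s -linearP -ql; congr (tr _ (q _ (t _ _ _ (_, _)))).
    by rewrite /= scaler0 addr0.
  by rewrite linearP.
- move=> a i j n l hi h hn hj r x; rewrite /s.
  have hj1 : a + (j - 1) = l - 1 by rewrite addrA hj.
  have h' : a + (j - 1 + 1) = l by rewrite subrK.
  have := t2 a j (j - 1) l (l - 1) hj (subrK 1 j) (subrK 1 l) hj1 r (0, tr (esym h) x).
  rewrite /= linear0 (act_tr _ _ (etrans hi (esym hn))).
  rewrite (tr_act _ _ (etrans hi (esym hn))).
  move=> e.
  have -> : ((0, lact (etrans hi (esym hn)) r x) : dg_cone f l) =
    (-1) ^ a *: ((0, (-1) ^ a *: lact (etrans hi (esym hn)) r x) : dg_cone f l).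
    by congr pair; rewrite /= ?scaler0 ?sgn_scaleK.
  rewrite (linZ (ql _ _ _)) e /=  sgn_scaleK linearZ /=; congr (_ *: _).
  by rewrite (tr_act _ _ h') (act_tr _ _ h').
- move=> i j l h h' x; case: i / h h' x => h' x; case: l / h'.
  rewrite (sE _ _ j _ erefl) /s /= (gE _ j erefl) !tr_id.
  have := t_eqn j (0, x); rewrite cone_dE linear0 add0r /= => /esym/(canRL (addKr _)) e.
  have -> : q j (t (j + 1) j erefl (f (j + 1) x, 0)) = 
     q j (t (j + 1) j erefl (f (j + 1) x, - cx_d erefl x)) +
     q j (t (j + 1) j erefl (0, cx_d erefl x)).
    by rewrite -(linD (ql _ _ _)); congr (q _ (t _ _ _ (_, _))); rewrite /= ?addr0 ?addNr.
  rewrite (d_tr _ _ (degS2 (subrK 1 j))) e; zmod.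
Qed.

Section ConeMap.
Variables (F G X Y : dgLeft R) (g : dgHom F G) (f : dgHom X Y).
Variables (p : dgHom F X) (q : dgHom G Y).
Hypothesis square : homotopic (dg_comp q g) (dg_comp f p).
Hypotheses (qp : quasi_iso p) (qq : quasi_iso q).

(** The homotopy of the square is the off-diagonal entry of the map of cones.
    That this map is a quasi-isomorphism is the five lemma. *)
Lemma quasi_iso_cone_map :
  exists h : dgHom (dg_cone g) (dg_cone f), quasi_iso h.
Proof.
have [s [s1 s2 s3]] := square.
pose h i (z : dg_cone g i) : dg_cone f i :=
  (q i z.1 + s (i + 1) i erefl z.2, p (i + 1) z.2).
have hl i : linear (@h i).
  move=> c x y; congr pair => /=; last exact: linearP.
  by rewrite linearP s1 /= scalerDr addrACA.
have sqE i (x : F i) j (e : j + 1 = i) : q i (g i x) =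
    f i (p i x) + cx_d e (s i j e x) + s (i + 1) i erefl (cx_d erefl x).
  by have /= /eqP := s3 i j _ e erefl x; rewrite subr_eq => /eqP ->; zmod.
have hd (i j : int) (e : i + 1 = j) (x : dg_cone g i) : h j (cx_d e x) = cx_d e (h i x).
  case: j / e; case: x => y x; rewrite !cone_dE /h /=.
  rewrite !linearD !linearN /= (linN (s1 _ _ _)) !dgh_d (sqE _ x i erefl).
  by congr pair; zmod.
have ha (i j n : int) (e : i + j = n) (r : R i) (x : dg_cone g j) :
    h n (lact e r x) = lact e r (h j x).
  congr pair => /=; last by rewrite linearZ /= dgh_act.
  rewrite dgh_act linearD (linZ (s1 _ _ _)) (s2 _ _ _ _ _ _ erefl _ e).
  by rewrite sgn_scaleK.
exists (DGHom hl hd ha) => n; have hn := subrK 1 n; split.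
- move=> [y x] /cone_cocycle /= [ey zx].
  (* [x] bounds some [x1], since [p] is injective on cohomology; subtracting the
     boundary of [(0, - x1)] leaves [(y + g x1, 0)], and [x3] corrects [y + g x1]
     to a coboundary. *)
  move=> /(coboundaryE hn) [[y' x'] e'].
  have [e1 e2] : q n y + s (n + 1) n erefl x = cx_d hn y' + f n (tr hn x') /\
     p (n + 1) x = - cx_d (degS2 hn) x' by case: e'.
  have /(coboundaryE (erefl (n + 1))) [x1 ex1] : coboundary x.
    apply: (qp _).1 => //; rewrite e2.
    by apply: coboundaryN; apply: coboundary_d.
  have zx'' : cocycle (tr hn x' + p n x1).
    apply/(cocycleE erefl); rewrite linearD /= -dgh_d ex1 e2.
    by rewrite (d_tr _ _ (degS2 hn)) addrN.
  have [x3 [zx3 [w' [hw' [w ew]]]]] := (qp n).2 _ zx''.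
  have e : w' = n - 1 by apply: (addIr 1); rewrite hw' hn.
  move/esym in e; case: w' / e hw' w ew => hw'.
  rewrite {hw'}(eq_irrelevance hw' hn) => w ew.
  have zy : cocycle (y + g n x1 - g n x3).
    apply: cocycleB; last exact: hom_cocycle.
    by apply/(cocycleE erefl); rewrite linearD /= -dgh_d ex1.
  have /(coboundaryE hn) [y3 ey3] : coboundary (y + g n x1 - g n x3).
    apply: (qq n).1 => //; apply/(coboundaryE hn).
    exists (y' + s n (n - 1) hn x1 - f _ w - s n (n - 1) hn x3).
    rewrite !linearB !linearD /= !(sqE _ _ _ hn) (zx3 _ erefl) (lin0 (s1 _ _ _)).
    rewrite -dgh_d ew ex1 (linB (@dgh_lin _ _ _ _ f n)) (linD (@dgh_lin _ _ _ _ f n)).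
    by rewrite -[q n y](addrK (s (n + 1) n erefl x)) e1; zmod.
  apply: (@cone_coboundary _ _ _ _ _ hn y3 (x3 - x1)) => /=.
    by rewrite ey3 linearB /=; zmod.
  by rewrite linearB /= (zx3 _ erefl) ex1 sub0r opprK.
- move=> [y x] /cone_cocycle /= [ey zx].
  have [x1 [zx1 /(coboundaryE (erefl (n + 1))) [w ew]]] := (qp (n + 1)).2 x zx.
  have eqx : q _ (g _ x1) = cx_d erefl (- y + f n w + s _ n erefl x1).
    rewrite (sqE _ _ n erefl) (zx1 _ erefl) (lin0 (s1 _ _ _)) !linearD linearN /=.
    rewrite -dgh_d ew linearB /=.
    by rewrite (canRL (addrK _) ey); zmod.
  have /(coboundaryE (erefl (n + 1))) [y1 ey1] : coboundary (g _ x1).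
    apply: (qq _).1; first exact: hom_cocycle.
    by rewrite eqx; apply: coboundary_d.
  have zc : cocycle (- q n y1 + s _ n erefl x1 - y + f n w).
    apply/(cocycleE erefl); rewrite !linearD !linearN /= -dgh_d ey1 eqx.
    by rewrite !linearD linearN /=; zmod.
  have [y2 [zy2 /(coboundaryE hn) [v ev]]] := (qq n).2 _ zc.
  exists (- y1 - y2, x1); split.
    apply/cone_cocycle => /=; split=> //.
    by rewrite linearB linearN /= (zy2 _ erefl) ey1; zmod.
  apply: (@cone_coboundary _ _ _ _ _ hn (- v) (- w)) => /=.
    by rewrite !linearN /= ev !linearB !linearN /=; zmod.
  by rewrite linearN /= opprK ew.
Qed.

End ConeMap.

End Cone.

(** * Infinite direct sums *)

(** A direct sum of copies of one module is represented by finitely supported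
    functions.  The index set is infinite in the telescope and may be infinite
    when cells are attached. *)
Section FiniteSupport.
Variables (k : fieldType) (I : choiceType) (V : lmodType k).

Definition fsupp : {pred I -> V} :=
  fun x => `[< exists s : seq I, forall t, t \notin s -> x t = 0 >].

Lemma fsuppP (x : I -> V) :
  reflect (exists s : seq I, forall t, t \notin s -> x t = 0) (x \in fsupp).
Proof. exact: asboolP. Qed.

Lemma fsupp_submod_closed : submod_closed fsupp.
Proof.
split=> [|a x y /fsuppP [s xs] /fsuppP [t yt]]; apply/fsuppP; first by exists [::].
exists (s ++ t) => u; rewrite mem_cat negb_or => /andP [us ut].
by rewrite (_ : (a *: x + y) u = a *: x u + y u) // xs // yt // scaler0 addr0.
Qed.
HB.instance Definition _ :=
  GRing.isSubmodClosed.Build k (I -> V) fsupp fsupp_submod_closed.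

Record fsfun := FSFun { fsval :> I -> V; fsvalP : fsval \in fsupp }.
HB.instance Definition _ := [isSub for fsval].
HB.instance Definition _ := [Choice of fsfun by <:].
HB.instance Definition _ := [SubChoice_isSubLmodule of fsfun by <:].
End FiniteSupport.

Section FiniteSupportTheory.
Variables (k : fieldType) (I : choiceType).
Implicit Types U V W : lmodType k.

Lemma fs_ext V (x y : fsfun I V) : (forall t, x t = y t) -> x = y.
Proof. by move=> e; apply: val_inj; apply: funext => t; apply: e. Qed.

Lemma fs_lin V (c : k) (x y : fsfun I V) t : (c *: x + y) t = c *: x t + y t.
Proof. by []. Qed.

Lemma fs_mapP U V (f : I -> U -> V) (x : fsfun I U) :
  (forall t, f t 0 = 0) -> (fun t => f t (x t)) \in @fsupp k I V.
Proof.
move=> f0; have /fsuppP [s xs] := fsvalP x; apply/fsuppP.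
by exists s => t /xs ->.
Qed.

Definition fs_map U V (f : I -> U -> V) (lf : forall t, linear (f t))
  (x : fsfun I U) : fsfun I V := FSFun (fs_mapP x (fun t => lin0 (lf t))).

Lemma fs_map_linear U V (f : I -> U -> V) (lf : forall t, linear (f t)) :
  linear (fs_map lf).
Proof. by move=> c x y; apply: fs_ext => t; apply: lf. Qed.

Lemma fs_singleP V (t : I) (v : V) :
  (fun u => if u == t then v else 0) \in @fsupp k I V.
Proof.
apply/fsuppP; exists [:: t] => u; rewrite inE => /negbTE -> //.
Qed.

Definition fs_single V t (v : V) : fsfun I V := FSFun (fs_singleP t v).

Lemma fs_single_linear V t : linear (@fs_single V t).
Proof.
move=> c x y; apply: fs_ext => u; rewrite fs_lin /=.
by case: eqP; rewrite ?scaler0 ?addr0.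
Qed.

Definition fs_list V (x : fsfun I V) : seq I :=
  undup (projT1 (cid (fsuppP _ (fsvalP x)))).

Lemma fs_listP V (x : fsfun I V) t : t \notin fs_list x -> x t = 0.
Proof. by rewrite mem_undup; case: cid => s /= xs; apply: xs. Qed.

Lemma fs_list_uniq V (x : fsfun I V) : uniq (fs_list x).
Proof. exact: undup_uniq. Qed.

Definition fs_sum V W (g : I -> V -> W) (x : fsfun I V) : W :=
  \sum_(t <- fs_list x) g t (x t).

(** Sums over two lists that both contain the support agree; this makes
    [fs_sum] independent of the list chosen for its argument. *)
Lemma sum_subseq W (g : I -> W) (s s' : seq I) :
  uniq s -> uniq s' -> (forall t, t \notin s -> g t = 0) ->
  {subset s <= s'} -> \sum_(t <- s) g t = \sum_(t <- s') g t.
Proof.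
move=> us us' gs sub; rewrite [RHS](bigID (mem s)) /= [X in _ + X]big1 => [|t];
  last first.
  by move/gs.
rewrite addr0 -[RHS]big_filter; apply: perm_big; apply: uniq_perm => //.
  exact: filter_uniq.
by move=> t; rewrite mem_filter; case: (boolP (t \in s)) => // /sub ->.
Qed.

Section Sum.
Variables (V W : lmodType k) (g : I -> V -> W).
Hypothesis lg : forall t, linear (g t).

Lemma fs_sumE (x : fsfun I V) s : uniq s -> (forall t, t \notin s -> x t = 0) ->
  fs_sum g x = \sum_(t <- s) g t (x t).
Proof.
move=> us xs; pose s' := undup (fs_list x ++ s).
have us' : uniq s' := undup_uniq _.
rewrite /fs_sum (sum_subseq (s' := s')) ?fs_list_uniq //; last 2 first.
- by move=> t /fs_listP ->; rewrite lin0.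
- by move=> t ts; rewrite mem_undup mem_cat ts.
rewrite -(sum_subseq (s := s)) //; first by move=> t /xs ->; rewrite lin0.
by move=> t ts; rewrite mem_undup mem_cat ts orbT.
Qed.

Lemma fs_sum_linear : linear (fs_sum g).
Proof.
move=> c x y; pose s := undup (fs_list x ++ fs_list y).
have us : uniq s := undup_uniq _.
have xs t : t \notin s -> x t = 0.
  by rewrite mem_undup mem_cat negb_or => /andP [/fs_listP].
have ys t : t \notin s -> y t = 0.
  by rewrite mem_undup mem_cat negb_or => /andP [_ /fs_listP].
rewrite !(fs_sumE us) // => [|t ts]; last first.
  by rewrite fs_lin xs // ys // scaler0 addr0.
by rewrite scaler_sumr -big_split; apply: eq_bigr => t _; rewrite fs_lin lg.
Qed.

Lemma fs_sum_single t v : fs_sum g (fs_single t v) = g t v.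
Proof.
rewrite (@fs_sumE _ [:: t]) // ?big_seq1 /= ?eqxx // => u.
by rewrite inE => /negbTE ->.
Qed.

End Sum.

Lemma fs_sum_map U V W (g : I -> V -> W) (f : I -> U -> V)
    (lg : forall t, linear (g t)) (lf : forall t, linear (f t)) x :
  fs_sum g (fs_map lf x) = fs_sum (fun t v => g t (f t v)) x.
Proof.
apply: (fs_sumE lg); first exact: fs_list_uniq.
by move=> t /fs_listP e; rewrite /= e lin0.
Qed.

Lemma fs_sum_comp V W W' (g : I -> V -> W) (L : W -> W') (x : fsfun I V) :
  linear L -> L (fs_sum g x) = fs_sum (fun t v => L (g t v)) x.
Proof.
move=> lL; rewrite /fs_sum; elim: (fs_list x) => [|t s IH].
  by rewrite !big_nil (lin0 lL).
by rewrite !big_cons (linD lL) IH.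
Qed.

Lemma fs_decomp V (x : fsfun I V) : fs_sum (@fs_single V) x = x.
Proof.
apply: fs_ext => u.
rewrite (@fs_sum_comp _ _ _ _ (fun y : fsfun I V => y u)) // /fs_sum /=.
case: (boolP (u \in fs_list x)) => ux; last first.
  rewrite big1_seq ?(fs_listP ux) // => t /andP [_ tx].
  by case: eqP => // e; move: ux; rewrite e tx.
rewrite (bigD1_seq u) ?fs_list_uniq //= eqxx big1 ?addr0 // => t tu.
by rewrite eq_sym (negbTE tu).
Qed.

(** Choosing the solution 0 wherever [x] vanishes keeps the support finite. *)
Lemma fs_choice U V (Q : U -> V -> Prop) (x : fsfun I U) :
  Q 0 0 -> (forall t, exists v, Q (x t) v) ->
  exists y : fsfun I V, forall t, Q (x t) (y t).
Proof.
move=> Q0 Qx.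
have /choice [y yP] : forall t, exists v, Q (x t) v /\ (x t = 0 -> v = 0).
  move=> t; case: (eqVneq (x t) 0) => [->|/eqP xt]; first by exists 0.
  by have [v Qv] := Qx t; exists v.
have ys : y \in @fsupp k I V.
  by apply/fsuppP; exists (fs_list x) => t /fs_listP /(yP t).2.
by exists (FSFun ys) => t; apply: (yP t).1.
Qed.

End FiniteSupportTheory.

Section DirectSum.
Variables (k : fieldType) (R : dgAlgebra k) (I : choiceType).
Implicit Types F M N : dgLeft R.

#[local] Obligation Tactic := idtac.
Program Definition cx_bigsum (C : complex k) : complex k :=
  @Complex k (fun i => fsfun I (C i))
    (fun _ _ h => fs_map (fun _ => cx_lin h)) _ _.
Next Obligation. by move=> C i j h; apply: fs_map_linear. Qed.
Next Obligation. by move=> C i j l h h' x; apply: fs_ext => t; apply: cx_dd. Qed.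

Program Definition dg_bigsum F : dgLeft R :=
  @DGLeft k R (cx_bigsum F)
    (fun _ _ _ h r => fs_map (fun _ => lact_linr h r)) _ _ _ _ _.
Next Obligation. by move=> F i j n h r; apply: fs_map_linear. Qed.
Next Obligation.
by move=> F i j n h x c r s; apply: fs_ext => t; apply: act_linear_l.
Qed.
Next Obligation. by move=> F *; apply: fs_ext => t; apply: lactA. Qed.
Next Obligation. by move=> F i h x; apply: fs_ext => t; apply: lact1. Qed.
Next Obligation. by move=> F *; apply: fs_ext => t; apply: lact_leibniz. Qed.

Program Definition bigsum_in F (t : I) : dgHom F (dg_bigsum F) :=
  @DGHom k R F (dg_bigsum F) (fun i => @fs_single k I (F i) t) _ _ _.
Next Obligation. by move=> F t i; apply: fs_single_linear. Qed.
Next Obligation.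
by move=> F t i j h x; apply: fs_ext => u /=; case: eqP; rewrite ?linear0.
Qed.
Next Obligation.
by move=> F t i j n h r x; apply: fs_ext => u /=; case: eqP; rewrite ?linear0.
Qed.

Program Definition bigsum_pr F (t : I) : dgHom (dg_bigsum F) F :=
  @DGHom k R (dg_bigsum F) F (fun i x => x t) _ _ _.
Next Obligation. by []. Qed.
Next Obligation. by []. Qed.
Next Obligation. by []. Qed.

Program Definition bigsum_map F M (p : dgHom F M) :
    dgHom (dg_bigsum F) (dg_bigsum M) :=
  @DGHom k R (dg_bigsum F) (dg_bigsum M)
    (fun i => fs_map (fun _ => @dgh_lin k R F M p i)) _ _ _.
Next Obligation. by move=> F M p i; apply: fs_map_linear. Qed.
Next Obligation. by move=> F M p i j h x; apply: fs_ext => t; apply: dgh_d. Qed.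
Next Obligation. by move=> F M p *; apply: fs_ext => t; apply: dgh_act. Qed.

Program Definition bigsum_out F M (p : I -> dgHom F M) : dgHom (dg_bigsum F) M :=
  @DGHom k R (dg_bigsum F) M (fun i => fs_sum (fun t => p t i)) _ _ _.
Next Obligation.
by move=> F M p i; apply: fs_sum_linear => t; apply: dgh_lin.
Qed.
Next Obligation.
move=> F M p i j h x; rewrite (fs_sum_comp _ _ (cx_lin h)) /=.
rewrite (fs_sum_map (fun t => @dgh_lin _ _ _ _ (p t) j)).
by congr fs_sum; apply: funext => t; apply: funext => y; apply: dgh_d.
Qed.
Next Obligation.
move=> F M p i j n h r x; rewrite (fs_sum_comp _ _ (lact_linr h r)) /=.
rewrite (fs_sum_map (fun t => @dgh_lin _ _ _ _ (p t) n)).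
by congr fs_sum; apply: funext => t; apply: funext => y; apply: dgh_act.
Qed.

Lemma orth_bigsum (S : int -> Prop) F : orth S F -> orth S (dg_bigsum F).
Proof.
move=> oF N f eN.
have /choice [s sP] : forall t, exists s : (forall i j : int, j + 1 = i -> F i -> N j),
    [/\ forall i j h, linear (s i j h),
      forall (a i j n l : int) (hi : a + i = n) (h : j + 1 = i)
            (hn : l + 1 = n) (hj : a + j = l) (r : R a) (x : F i),
          s n l hn (lact hi r x) = (-1) ^ a *: lact hj r (s i j h x) &
      forall (i j l : int) (h : j + 1 = i) (h' : i + 1 = l) (x : F i),
          f i (fs_single t x) = cx_d h (s i j h x) + s l i h' (cx_d h' x)].
  by move=> t; apply: (oF N (dg_comp f (bigsum_in F t)) eN).
exists (fun i j h => fs_sum (fun t => s t i j h)); split.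
- by move=> i j h; apply: fs_sum_linear => t; have [s1 _ _] := sP t; apply: s1.
- move=> a i j n l hi h hn hj r x.
  rewrite (fs_sum_comp _ _ (lact_linr hj r)) fs_sum_map => [|t]; last first.
    by have [s1 _ _] := sP t; apply: s1.
  rewrite /fs_sum scaler_sumr; apply: eq_bigr => t _.
  by have [_ s2 _] := sP t; apply: s2.
- move=> i j l h h' x.
  rewrite (fs_sum_comp _ _ (cx_lin h)) fs_sum_map => [|t]; last first.
    by have [s1 _ _] := sP t; apply: s1.
  rewrite -[in LHS](fs_decomp x) (fs_sum_comp _ _ (@dgh_lin _ _ _ _ f i)).
  rewrite /fs_sum -big_split; apply: eq_bigr => t _.
  by have [_ _ s3] := sP t; apply: s3.
Qed.

Lemma bigsum_cocycle (C : complex k) i (x : cx_bigsum C i) :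
  cocycle x <-> forall t, cocycle (x t).
Proof.
split=> [zx t l h|zx l h]; last by apply: fs_ext => t; apply: zx.
by have := congr1 (fun y : cx_bigsum C l => y t) (zx l h).
Qed.

Lemma bigsum_coboundary (C : complex k) i (x : cx_bigsum C i) :
  coboundary x <-> forall t, coboundary (x t).
Proof.
have h := subrK 1 i.
split=> [/(coboundaryE h) [y <-] t|bx]; first exact: coboundary_d.
have [|t|y yP] := @fs_choice k I (C i) (C (i - 1)) (fun u v => cx_d h v = u) x.
- exact: linear0.
- exact/(coboundaryE h).
- by apply/(coboundaryE h); exists y; apply: fs_ext => t; apply: yP.
Qed.

Lemma quasi_iso_bigsum F M (p : dgHom F M) :
  quasi_iso p -> quasi_iso (bigsum_map p).
Proof.
move=> qp i; have [inj surj] := qp i; split=> [x|y].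
  move=> /bigsum_cocycle zx /bigsum_coboundary bx; apply/bigsum_coboundary => t.
  by apply: inj => //; apply: bx.
move=> /bigsum_cocycle zy.
have [|t|x xP] := @fs_choice k I (M i) (F i)
    (fun u v => cocycle v /\ coboundary (p i v - u)) y.
- by split; [apply: cocycle0|rewrite linear0 subr0; apply: coboundary0].
- exact: surj.
- exists x; split; first by apply/bigsum_cocycle => t; apply: (xP t).1.
  by apply/bigsum_coboundary => t; apply: (xP t).2.
Qed.

End DirectSum.

(** * The module R *)

Section Regular.
Variables (k : fieldType) (R : dgAlgebra k).
Implicit Types (F M N : dgLeft R) (S : int -> Prop).

Lemma dga_d_one j (h : 0 + 1 = j) : cx_d h (dga_one R) = 0.
Proof.
have h' : j + 0 = j := addr0 j.
have h'' : 0 + j = j := add0r j.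
have := dga_leibniz (addr0 0) h h h h' h'' (dga_one R) (dga_one R).
rewrite !dga_mul1 dga_mulr1 expr0z scale1r.
by move/eqP; rewrite -subr_eq subrr => /eqP.
Qed.

(** A map out of [R] is determined by the image of 1, a cocycle of degree 0;
    a cochain [w] bounding it gives the homotopy [r |-> +- r w]. *)
Lemma orth_regular : orth (fun j => j = 0) (dg_regular R).
Proof.
move=> N f eN.
have /(coboundaryE (addNr 1)) [w ew] : coboundary (f 0 (dga_one R)).
  apply: (eN 0 erefl); apply/(cocycleE (add0r 1)); rewrite -dgh_d.
  by rewrite (_ : cx_d _ _ = 0) ?linear0 //; apply: dga_d_one.
have hs (i j : int) : j + 1 = i -> i + -1 = j by move=> <-; rewrite addrK.
exists (fun i j h r => (-1) ^ i *: lact (hs i j h) r w); split.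
- by move=> i j h c x y; rewrite act_linear_l scalerDr !scalerA mulrC.
- move=> a i j n l hi h hn hj r x /=.
  rewrite linearZ /= (lactA hi (hs _ _ hn)) scalerA -sgnD.
  by congr (_ ^ _ *: _); rewrite -hi.
- move=> i j l h h' x /=.
  have e1 : i + -1 + 1 = i := subrK 1 i.
  rewrite linearZ /= (lact_leibniz (hs i j h) h h' (addNr 1) (hs l i h') (addr0 i)).
  rewrite ew scalerDr sgn_scaleK (sgnS _ h') scaleNr [RHS]addrAC subrr add0r.
  have /= <- := dgh_act f (addr0 i) x (dga_one R).
  by rewrite dga_mulr1.
Qed.

End Regular.

(** * Isomorphisms of the derived category *)

Section DerivedCategory.
Variables (k : fieldType) (R : dgAlgebra k).
Implicit Types (F L M N : dgLeft R).

(** The effect of a morphism of the derived category on cohomology, as a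
    relation between representing cocycles. *)
Fixpoint H_rel M N (u : dmor M N) (i : int) : M i -> N i -> Prop :=
  match u in dmor M N return M i -> N i -> Prop with
  | dm_map _ _ f => fun x y => coboundary (f i x - y)
  | dm_inv _ _ s _ => fun x y => coboundary (s i y - x)
  | dm_comp _ _ _ v u => fun x z =>
      exists y, [/\ cocycle y, H_rel u x y & H_rel v y z]
  end.

Lemma coboundary_sym (C : complex k) i (x y : C i) :
  coboundary (x - y) -> coboundary (y - x).
Proof. by move/coboundaryN; rewrite opprB. Qed.

Lemma coboundary_trans (C : complex k) i (y x z : C i) :
  coboundary (x - y) -> coboundary (y - z) -> coboundary (x - z).
Proof. by move=> b /(coboundaryD b); rewrite addrA subrK. Qed.

Lemma hom_coboundaryB M N (f : dgHom M N) i (x y : M i) :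
  coboundary (x - y) -> coboundary (f i x - f i y).
Proof. by move/(hom_coboundary f); rewrite linearB. Qed.

Lemma quasi_iso_injB M N (f : dgHom M N) i (x y : M i) : quasi_iso f ->
  cocycle x -> cocycle y -> coboundary (f i x - f i y) -> coboundary (x - y).
Proof.
by move=> qf zx zy; rewrite -linearB; apply: (qf i).1; apply: cocycleB.
Qed.

Lemma H_rel_total M N (u : dmor M N) i (x : M i) :
  cocycle x -> exists2 y, cocycle y & H_rel u x y.
Proof.
elim: u x => {M N} [M N f|M N s qs|L M N v IHv u IHu] x zx /=.
- exists (f i x); first exact: hom_cocycle.
  by rewrite subrr; apply: coboundary0.
- by have [y [zy b]] := (qs i).2 x zx; exists y.
- by have [y zy xy] := IHu x zx; have [z zz yz] := IHv y zy; exists z => //; exists y.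
Qed.

Lemma H_rel_fun M N (u : dmor M N) i (x x' : M i) (y y' : N i) :
  cocycle y -> cocycle y' -> coboundary (x - x') ->
  H_rel u x y -> H_rel u x' y' -> coboundary (y - y').
Proof.
elim: u x x' y y' => {M N} [M N f|M N s qs|L M N v IHv u IHu] x x' y y' zy zy' xx /=.
- move=> b b'; apply: coboundary_trans b'.
  by apply: coboundary_trans (hom_coboundaryB f xx); apply: coboundary_sym.
- move=> b b'; apply: (quasi_iso_injB qs) => //.
  by apply: (coboundary_trans b); apply: (coboundary_trans xx); apply: coboundary_sym.
- move=> [z [zz xz zy1]] [z' [zz' xz' zy1']].
  exact: IHv (IHu _ _ _ _ zz zz' xx xz xz') zy1 zy1'.
Qed.

Lemma H_rel_closed M N (u : dmor M N) i (x x' : M i) (y y' : N i) :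
  coboundary (x - x') -> coboundary (y - y') -> H_rel u x y -> H_rel u x' y'.
Proof.
elim: u x x' y y' => {M N} [M N f|M N s qs|L M N v IHv u IHu] x x' y y' xx yy /=.
- move=> b; apply: coboundary_trans yy; apply: coboundary_trans b.
  by apply: hom_coboundaryB; apply: coboundary_sym.
- move=> b; apply: coboundary_trans xx; apply: coboundary_trans b.
  by apply: hom_coboundaryB; apply: coboundary_sym.
- move=> [z [zz xz zy]]; exists z; split=> //.
    by apply: IHu xz => //; rewrite subrr; apply: coboundary0.
  by apply: IHv zy => //; rewrite subrr; apply: coboundary0.
Qed.

Lemma H_rel0 M N (u : dmor M N) i : H_rel u (0 : M i) (0 : N i).
Proof.
elim: u => {M N} [M N f|M N s qs|L M N v IHv u IHu] /=.
- by rewrite linear0 subr0; apply: coboundary0.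
- by rewrite linear0 subr0; apply: coboundary0.
- by exists 0; split=> //; apply: cocycle0.
Qed.

(** Cohomology inverts quasi-isomorphisms, so it respects the relations that
    define the localisation. *)
Lemma H_rel_eq M N (u v : dmor M N) i (x : M i) (y : N i) : dm_eq u v ->
  cocycle x -> cocycle y -> H_rel u x y <-> H_rel v x y.
Proof.
have refl0 (C : complex k) (z : C i) : coboundary (z - z).
  by rewrite subrr; apply: coboundary0.
move=> uv; elim: uv x y => {M N u v}
  [M N u|M N u v _ IH|M N u v w _ IH1 _ IH2|L M N v v' u u' _ IHv _ IHu
  |K L M N w v u|M N u|M N u|L M N g f|M N s qs|M N s qs] x y zx zy.
- by [].
- by rewrite IH.
- by rewrite IH1 ?IH2.
- split=> -[z [zz xz zy1]]; exists z.
    by split=> //; [apply/IHu|apply/IHv].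
  by split=> //; [apply/IHu|apply/IHv].
- split=> /=.
    move=> [z [zz [t [zt xt tz]] zy1]]; exists t; split=> //; by exists z.
  move=> [t [zt xt [z [zz tz zy1]]]]; exists z; split=> //; by exists t.
- split=> /= [[z [zz xz zy1]]|xy]; last by exists y; split.
  exact: H_rel_closed xz.
- split=> /= [[z [zz xz zy1]]|xy]; last by exists x; split.
  by apply: H_rel_closed zy1 => //; apply: coboundary_sym.
- split=> /= [b|[z [zz xz zy1]]].
    by exists (f i x); split=> //; apply: hom_cocycle.
  by apply: coboundary_trans zy1; apply: hom_coboundaryB.
- split=> /= [[z [zz xz zy1]]|xy].
    apply: (quasi_iso_injB qs) => //; apply: (coboundary_trans xz).
    exact: coboundary_sym.
  exists (s i x); split=> //; first exact: hom_cocycle.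
  by apply: coboundary_sym; apply: hom_coboundaryB.
- split=> /= [[z [zz xz zy1]]|xy].
    by apply: coboundary_trans zy1; apply: coboundary_sym.
  have [z [zz b]] := (qs i).2 x zx.
  by exists z; split=> //; apply: (coboundary_trans b).
Qed.

(** A formal zigzag starting at [M] can be followed from a K-projective [F]
    over [M] by honest homomorphisms, whatever the modules on its way. *)
Lemma dmor_lift F M N (u : dmor M N) (p : dgHom F M) :
  orth (fun _ => True) F -> exists q : dgHom F N,
  forall i (x : F i), cocycle x -> H_rel u (p i x) (q i x).
Proof.
move=> oF; elim: u p => {M N} [M N f|M N s qs|L M N v IHv u IHu] p.
- exists (dg_comp f p) => i x zx /=; rewrite subrr; exact: coboundary0.
- have [q sq] := lift_quasi_iso p oF qs; exists q => i x zx /=.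
  exact: (null_coboundary sq zx).
- have [q pq] := IHu p; have [r qr] := IHv q; exists r => i x zx /=.
  by exists (q i x); split; [apply: hom_cocycle|apply: pq|apply: qr].
Qed.

(** The lift of an isomorphism induces on cohomology the composite of two
    bijections. *)
Lemma D_iso_resolution F M N (p : dgHom F M) :
  orth (fun _ => True) F -> quasi_iso p -> D_iso M N ->
  exists q : dgHom F N, quasi_iso q.
Proof.
move=> oF qp [u [v [vu uv]]].
have [q pq] := dmor_lift u p oF; exists q => i.
split=> [x zx bqx|y zy].
  have zp := hom_cocycle p zx; have zq := hom_cocycle q zx.
  have [z zz qz] := H_rel_total v zq.
  have /(H_rel_eq vu zp zz) /= bz : H_rel (dm_comp v u) (p i x) z.
    by exists (q i x); split=> //; apply: pq.
  have b0 : coboundary (z - 0).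
    apply: (H_rel_fun zz (@cocycle0 _ _ _) _ qz (H_rel0 v i)).
    by rewrite subr0.
  apply: (qp i).1 => //; rewrite -[p i x]subr0.
  exact: coboundary_trans bz b0.
have [z zz yz] := H_rel_total v zy.
have [x [zx bx]] := (qp i).2 z zz.
exists x; split=> //.
have zp := hom_cocycle p zx; have zq := hom_cocycle q zx.
have /(H_rel_eq uv zy zq) /= : H_rel (dm_comp u v) y (q i x).
  exists (p i x); split=> //; last exact: pq.
  apply: H_rel_closed yz; last exact: coboundary_sym.
  by rewrite subrr; apply: coboundary0.
exact: coboundary_sym.
Qed.

End DerivedCategory.

(** * Resolutions of compact objects *)

Section Resolutions.
Variables (k : fieldType) (R : dgAlgebra k).
Implicit Types (F L M N : dgLeft R).

Lemma D_iso_sym M N : D_iso M N -> D_iso N M.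
Proof. by move=> [u [v [vu uv]]]; exists v, u. Qed.

Lemma quasi_iso_D_iso M N (f : dgHom M N) : quasi_iso f -> D_iso M N.
Proof.
move=> qf; exists (dm_map f), (dm_inv qf).
by split; [apply: dm_invl|apply: dm_invr].
Qed.

Lemma acyclic_D_iso_zero M : (forall j, exact_at M j) -> D_iso M (dg_zero R).
Proof.
move=> aM; apply: (@quasi_iso_D_iso _ _ (dg_null M (dg_zero R))) => i; split.
  by move=> x /aM.
move=> y _; exists 0; split; first exact: cocycle0.
by rewrite [_ - y]thinmx0; apply: coboundary0.
Qed.

Lemma quasi_iso_exact M N (f : dgHom M N) i :
  quasi_iso f -> exact_at M i <-> exact_at N i.
Proof.
move=> qf; have [inj surj] := qf i; split=> ex x zx.
  have [y [zy b]] := surj x zx.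
  have -> : x = f i y - (f i y - x) by rewrite subKr.
  by apply: coboundaryB => //; apply/hom_coboundary/ex.
by apply: inj => //; apply/ex/hom_cocycle.
Qed.

Lemma quasi_iso_comp L M N (g : dgHom M N) (f : dgHom L M) :
  quasi_iso g -> quasi_iso f -> quasi_iso (dg_comp g f).
Proof.
move=> qg qf i; split=> /= [x zx b|z zz].
  by apply: (qf i).1 => //; apply: (qg i).1 => //; apply: hom_cocycle.
have [y [zy b]] := (qg i).2 z zz; have [x [zx b']] := (qf i).2 y zy.
exists x; split=> //; apply: coboundary_trans b.
exact: hom_coboundaryB.
Qed.

Lemma quasi_iso_bij M N (f : dgHom M N) :
  (forall i (x : M i), f i x = 0 -> x = 0) ->
  (forall i (y : N i), exists x, f i x = y) -> quasi_iso f.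
Proof.
move=> inj surj i; have h := subrK 1 i; split=> [x zx|y zy].
  move=> /(coboundaryE h) [y ey]; have [z ez] := surj _ y.
  apply/(coboundaryE h); exists z; apply/eqP; rewrite -subr_eq0; apply/eqP.
  by apply: inj; rewrite linearB /= dgh_d ez ey subrr.
have [x ex] := surj _ y; exists x; split; last by rewrite ex subrr; apply: coboundary0.
by move=> l hl; apply: inj; rewrite dgh_d ex zy.
Qed.

Lemma exact_at_cone M N (f : dgHom M N) n :
  exact_at N n -> exact_at M (n + 1) -> exact_at (dg_cone f) n.
Proof.
move=> eN eM [y x] /cone_cocycle /= [ey /eM /(coboundaryE (erefl (n + 1))) [x1 ex1]].
have h := subrK 1 n.
have /eN /(coboundaryE h) [w ew] : cocycle (y + f n x1).
  by apply/(cocycleE erefl); rewrite linearD /= -dgh_d ex1.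
apply: (@cone_coboundary _ _ _ _ _ _ _ h w (- x1)) => /=; rewrite linearN /=.
  by rewrite ew addrK.
by rewrite ex1 opprK.
Qed.

#[local] Obligation Tactic := idtac.

Program Definition shift_of_sh M : dgHom (dg_sh 1 M) (dg_shift M) :=
  @DGHom k R (dg_sh 1 M) (dg_shift M) (fun i x => x) _ _ _.
Next Obligation. by []. Qed.
Next Obligation.
move=> M i j h x /=; rewrite expr1z scaleN1r.
by rewrite (eq_irrelevance (sh_deg_d 1 h) (degS2 h)).
Qed.
Next Obligation.
move=> M i j n h r x /=; rewrite mul1r.
by rewrite (eq_irrelevance (sh_deg 1 h) (degS h)).
Qed.

Program Definition unshift_map M : dgHom (dg_sh (-1) (dg_shift M)) M :=
  @DGHom k R (dg_sh (-1) (dg_shift M)) M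
    (fun i => @tr k M (i - 1 + 1) i (subrK 1 i)) _ _ _.
Next Obligation. by move=> M i c x y; apply: tr_linear. Qed.
Next Obligation.
move=> M i j h x; have h' : i - 1 + 1 + 1 = j by rewrite subrK.
rewrite (d_tr _ _ h') /= sgn_neg expr1z scaleN1r opprK.
exact: tr_d.
Qed.
Next Obligation.
move=> M i j n h r x; have h' : i + (j - 1 + 1) = n by rewrite subrK.
rewrite (act_tr _ _ h') /= scalerA -sgnD.
rewrite (@sgn_parity _ _ 0 0) ?expr0z ?scale1r; last by ring.
exact: tr_act.
Qed.

(** Besides the resolution, a lower bound on the cohomology is kept: it is where
    the removal of bottom cells starts. *)
Definition bounded_resolution M : Prop :=
  exists (F : dgLeft R) (p : dgHom F M) (D a : int),
    [/\ quasi_iso p, orth (fun j => j <= D) F & forall j, j < a -> exact_at M j].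

Lemma orth_K_projective (S : int -> Prop) F : orth S F -> orth (fun _ => True) F.
Proof. exact: orth_sub. Qed.

Lemma bounded_resolution_iso M N :
  D_iso M N -> bounded_resolution M -> bounded_resolution N.
Proof.
move=> MN [F [p [D [a [qp oF eM]]]]].
have [q qq] := D_iso_resolution (orth_K_projective oF) qp MN.
exists F, q, D, a; split=> // j /eM eMj.
by apply/(quasi_iso_exact _ qq)/(quasi_iso_exact _ qp).
Qed.

Lemma orth_cone_le (D : int) M N (f : dgHom M N) :
  orth (fun j => j <= D) N -> orth (fun j => j <= D) M ->
  orth (fun j => j <= D) (dg_cone f).
Proof.
move=> oN oM; apply: orth_cone => //.
by apply: orth_sub (orth_sh (a := 1) oM) => j /=; lia.
Qed.

Lemma bounded_resolution_cone M N (f : dgHom M N) :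
  bounded_resolution M -> bounded_resolution N -> bounded_resolution (dg_cone f).
Proof.
move=> [F [p [D [a [qp oF eM]]]]] [G [q [D' [a' [qq oG eN]]]]].
have [g square] := lift_quasi_iso (dg_comp f p) (orth_K_projective oF) qq.
have [h qh] := quasi_iso_cone_map square qp qq.
exists (dg_cone g), h, (Num.max D D'), (Num.min (a - 1) a'); split=> //.
  by apply: orth_cone_le; [apply: orth_sub oG|apply: orth_sub oF] => j;
    rewrite le_max => ->; rewrite ?orbT.
move=> j; rewrite lt_min => /andP [ja ja'].
by apply: exact_at_cone; [apply: eN|apply: eM; lia].
Qed.

Lemma exact_at_sum M N j :
  exact_at (dg_sum M N) j <-> exact_at M j /\ exact_at N j.
Proof.
have h := subrK 1 j; split=> [ex|[eM eN] [x y] z]; last first.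
  have /eM /(coboundaryE h) [u eu] : cocycle x.
    by apply/(cocycleE erefl); have [] := z _ erefl.
  have /eN /(coboundaryE h) [v ev] : cocycle y.
    by apply/(cocycleE erefl); have [] := z _ erefl.
  by apply/(coboundaryE h); exists (u, v); rewrite /= eu ev.
split=> x zx.
  have /ex /(coboundaryE h) [[u v] [eu _]] : cocycle ((x, 0) : dg_sum M N j).
    by move=> l hl; rewrite /= zx linear0.
  by apply/(coboundaryE h); exists u.
have /ex /(coboundaryE h) [[u v] [_ ev]] : cocycle ((0, x) : dg_sum M N j).
  by move=> l hl; rewrite /= zx linear0.
by apply/(coboundaryE h); exists v.
Qed.

Lemma orth_sum (S : int -> Prop) M N : orth S M -> orth S N -> orth S (dg_sum M N).
Proof.
move=> oM oN L f eL.
have l1 i : linear (fun x : M i => ((x, 0) : dg_sum M N i)).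
  by move=> c x y; congr pair; rewrite /= ?scaler0 ?addr0.
have l2 i : linear (fun x : N i => ((0, x) : dg_sum M N i)).
  by move=> c x y; congr pair; rewrite /= ?scaler0 ?addr0.
have d1 (i j : int) (h : i + 1 = j) (x : M i) :
    ((cx_d h x, 0) : dg_sum M N j) = cx_d h ((x, 0) : dg_sum M N i).
  by rewrite /= linear0.
have d2 (i j : int) (h : i + 1 = j) (x : N i) :
    ((0, cx_d h x) : dg_sum M N j) = cx_d h ((0, x) : dg_sum M N i).
  by rewrite /= linear0.
have a1 (i j n : int) (h : i + j = n) (r : R i) (x : M j) :
    ((lact h r x, 0) : dg_sum M N n) = lact h r ((x, 0) : dg_sum M N j).
  by rewrite /= linear0.
have a2 (i j n : int) (h : i + j = n) (r : R i) (x : N j) :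
    ((0, lact h r x) : dg_sum M N n) = lact h r ((0, x) : dg_sum M N j).
  by rewrite /= linear0.
have [s [s1 s2 s3]] := oM _ (dg_comp f (DGHom l1 d1 a1)) eL.
have [t [t1 t2 t3]] := oN _ (dg_comp f (DGHom l2 d2 a2)) eL.
exists (fun i j h z => s i j h z.1 + t i j h z.2); split.
- by move=> i j h c x y; rewrite /= s1 t1 scalerDr addrACA.
- move=> a i j n l hi h hn hj r z /=.
  by rewrite (s2 _ _ _ _ _ _ h _ hj) (t2 _ _ _ _ _ _ h _ hj) linearD scalerDr.
- move=> i j l h h' [x y] /=.
  have -> : f i (x, y) = f i (x, 0) + f i (0, y).
    by rewrite -linearD; congr (f i (_, _)); rewrite /= ?addr0 ?add0r.
  have /= -> := s3 i j l h h' x; have /= -> := t3 i j l h h' y.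
  by rewrite linearD addrACA.
Qed.

Lemma quasi_iso_sum M N M' N' (p : dgHom M M') (q : dgHom N N') :
  quasi_iso p -> quasi_iso q ->
  exists f : dgHom (dg_sum M N) (dg_sum M' N'), quasi_iso f.
Proof.
move=> qp qq.
have fl i : linear (fun z : dg_sum M N i => ((p i z.1, q i z.2) : dg_sum M' N' i)).
  by move=> c x y; rewrite !linearP.
have fd (i j : int) (h : i + 1 = j) (z : dg_sum M N i) :
    ((p j (cx_d h z).1, q j (cx_d h z).2) : dg_sum M' N' j) =
    cx_d h ((p i z.1, q i z.2) : dg_sum M' N' i).
  by rewrite /= !dgh_d.
have fa (i j n : int) (h : i + j = n) (r : R i) (z : dg_sum M N j) :
    ((p n (lact h r z).1, q n (lact h r z).2) : dg_sum M' N' n) =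
    lact h r ((p j z.1, q j z.2) : dg_sum M' N' j).
  by rewrite /= !dgh_act.
exists (DGHom fl fd fa) => i; have h := subrK 1 i.
have co (A B : dgLeft R) (z : dg_sum A B i) :
    cocycle z <-> cocycle z.1 /\ cocycle z.2.
  split=> [zz|[z1 z2] l hl]; last by rewrite /= z1 z2.
  by split; apply/(cocycleE erefl); have [] := zz _ erefl.
have cb (A B : dgLeft R) (z : dg_sum A B i) :
    coboundary z <-> coboundary z.1 /\ coboundary z.2.
  split=> [/(coboundaryE h) [w <-]|[/(coboundaryE h) [x ex] /(coboundaryE h) [y ey]]].
    by split; apply: coboundary_d.
  by apply/(coboundaryE h); exists (x, y); rewrite /= ex ey; case: z {ex ey}.
split=> [z /co [z1 z2] /cb [b1 b2]|z /co [z1 z2]].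
  by apply/cb; split; [apply: (qp i).1|apply: (qq i).1].
have [x [zx bx]] := (qp i).2 _ z1; have [y [zy b']] := (qq i).2 _ z2.
by exists (x, y); split; [apply/co|apply/cb].
Qed.

End Resolutions.

(** Write an element of a countable sum of copies of [M (+) N] as a sequence
    [(m_t, n_t)].  The endomorphism [push] moves each [m_t] to position [t + 1]
    and fixes the [n_t].  It is injective, and its cokernel is [M], read off at
    [m_0]; so [M] is quasi-isomorphic to its cone. *)
Section Telescope.
Variables (k : fieldType) (R : dgAlgebra k) (M N : dgLeft R).
Let T := dg_sum M N.
Let TT := dg_bigsum nat T.

Lemma push_fsupp i (x : TT i) :
  (fun t => (if t is t'.+1 then (x t').1 else 0, (x t).2) : T i)
    \in @fsupp k nat (T i).
Proof.
apply/fsuppP; exists (fs_list x ++ map S (fs_list x)) => t.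
rewrite mem_cat negb_or => /andP [/fs_listP xt]; rewrite xt.
case: t {xt} => // t; rewrite mem_map; last exact: succn_inj.
by move/fs_listP => ->.
Qed.

Lemma pull_fsupp i (x : TT i) :
  (fun t => ((x t.+1).1, (x t).2) : T i) \in @fsupp k nat (T i).
Proof.
apply/fsuppP; exists (fs_list x ++ map predn (fs_list x)) => t.
rewrite mem_cat negb_or => /andP [/fs_listP xt xt1]; rewrite xt fs_listP //.
by apply: contra xt1 => e; apply/mapP; exists t.+1.
Qed.

Definition pull i (x : TT i) : TT i := FSFun (pull_fsupp x).

#[local] Obligation Tactic := idtac.
Program Definition push : dgHom TT TT :=
  @DGHom k R TT TT (fun i x => FSFun (push_fsupp x)) _ _ _.
Next Obligation.
move=> i c x y; apply: fs_ext => -[|t] //.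
by congr pair; rewrite /= scaler0 addr0.
Qed.
Next Obligation.
by move=> i j h x; apply: fs_ext => -[|t] //; congr pair; rewrite linear0.
Qed.
Next Obligation.
by move=> i j n h r x; apply: fs_ext => -[|t] //; congr pair; rewrite linear0.
Qed.

Lemma push_inj i (x : TT i) : push i x = 0 -> x = 0.
Proof.
move=> e; apply: fs_ext => t.
have := congr1 (fun z : TT i => (z t.+1).1) e; have := congr1 (fun z : TT i => (z t).2) e.
by move=> /= e2 e1; rewrite [x t]surjective_pairing e1 e2.
Qed.

Lemma push_pull i (x : TT i) : (x 0%N).1 = 0 -> push i (pull x) = x.
Proof.
move=> x0; apply: fs_ext => -[|t] /=; last by rewrite -surjective_pairing.
by rewrite -{1}x0 -surjective_pairing.
Qed.

Program Definition telescope_map : dgHom (dg_cone push) M :=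
  @DGHom k R (dg_cone push) M (fun i z => (z.1 0%N).1) _ _ _.
Next Obligation. by []. Qed.
Next Obligation. by move=> i j h z; case: j / h => /=; rewrite addr0. Qed.
Next Obligation. by []. Qed.

Lemma quasi_iso_telescope : quasi_iso telescope_map.
Proof.
move=> i; have h := subrK 1 i; split=> [[y x]|m zm].
  move=> /cone_cocycle [ey zx] /(coboundaryE h) [w ew].
  pose v : TT (i - 1) := fs_single 0%N ((w, 0) : T (i - 1)).
  (* After the class at [m_0] is removed, [y] is in the image of [push]. *)
  have y0 : ((y - cx_d h v : TT i) 0%N).1 = 0.
    by rewrite /= ew subrr.
  move: (pull _) (push_pull y0) => x' ex'.
  have dx' : cx_d erefl x' = - x.
    apply/eqP; rewrite -addr_eq0; apply/eqP/push_inj.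
    rewrite (linD (@dgh_lin _ _ _ _ push _)) dgh_d ex' (linB (cx_lin _)) cx_dd subr0.
    exact: ey.
  apply: (@cone_coboundary _ _ _ _ _ _ _ h v x').
    by rewrite ex' addrCA subrr addr0.
  by rewrite dx' opprK.
pose v : TT i := fs_single 0%N ((m, 0) : T i).
exists (v, 0); split; last by rewrite /= subrr; apply: coboundary0.
apply/cone_cocycle; split; last exact: cocycle0.
have -> : push (i + 1) ((v, 0) : dg_cone push i).2 = 0 by apply: linear0.
rewrite addr0; apply: fs_ext => -[|t] /=; last by congr pair; apply: linear0.
by congr pair; [apply: zm|apply: linear0].
Qed.

End Telescope.

Section Compact.
Variables (k : fieldType) (R : dgAlgebra k).

Lemma bounded_resolution_summand (M N : dgLeft R) :
  bounded_resolution (dg_sum M N) -> bounded_resolution M.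
Proof.
move=> [F [p [D [a [qp oF eMN]]]]].
have oFF := orth_bigsum (I := nat) oF.
have qpp := quasi_iso_bigsum nat qp.
have [g square] := lift_quasi_iso (dg_comp (push M N) (bigsum_map nat p))
  (orth_K_projective oFF) qpp.
have [h qh] := quasi_iso_cone_map square qpp qpp.
exists (dg_cone g), (dg_comp (telescope_map M N) h), D, a; split.
- exact: quasi_iso_comp (quasi_iso_telescope M N) qh.
- exact: orth_cone_le.
- by move=> j /eMN /exact_at_sum [].
Qed.

Lemma exact_at_regular_neg (R_neg : forall (j : int) (r : R j), j < 0 -> r = 0) j :
  j < 0 -> exact_at R j.
Proof. by move=> j0 x _; rewrite (R_neg _ x j0); apply: coboundary0. Qed.

(** The bound of a cone is the larger of the two bounds, shifts move the
    bound, and a summand is resolved by its telescope. *)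
Lemma compact_bounded_resolution (M : dgLeft R) :
  (forall (j : int) (r : R j), j < 0 -> r = 0) ->
  D_compact M -> bounded_resolution M.
Proof.
move=> R_neg; elim=> {M} [|M N MN _ IH|L M N [X [Y [f [LX MY NC]]]] _ IHL _ IHM
  |M _ [F [p [D [a [qp oF eM]]]]]|M _ [F [p [D [a [qp oF eM]]]]]|
  |M N _ [F [p [D [a [qp oF eM]]]]] _ [G [q [D' [a' [qq oG eN]]]]]|M N _ IH].
- exists (dg_regular R), (dg_id _), 0, 0; split.
  + by apply: quasi_iso_bij => // i y; exists y.
  + by apply: orth_sub (@orth_regular _ R) => j ->.
  + exact: exact_at_regular_neg.
- exact: bounded_resolution_iso MN IH.
- apply: bounded_resolution_iso (D_iso_sym NC) _.
  by apply: bounded_resolution_cone; [apply: bounded_resolution_iso LX IHL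
    |apply: bounded_resolution_iso MY IHM].
- exists (dg_sh 1 F), (dg_comp (shift_of_sh M) (dg_sh_map 1 p)), (D - 1), (a - 1).
  split.
  + apply: quasi_iso_comp; last exact: quasi_iso_sh.
    by apply: quasi_iso_bij => // i y; exists y.
  + by apply: orth_sub (orth_sh (a := 1) oF) => j /=; lia.
  + by move=> j ja; apply/(exact_at_shift _ (erefl (j + 1)))/eM; lia.
- exists (dg_sh (-1) F), (dg_comp (unshift_map M) (dg_sh_map (-1) p)), (D + 1), (a + 1).
  split.
  + apply: quasi_iso_comp; last exact: quasi_iso_sh.
    apply: quasi_iso_bij => i y /=.
      by move/(congr1 (tr (esym (subrK 1 i)))); rewrite linear0 (tr_tr _ _ erefl) tr_id.
    by exists (tr (esym (subrK 1 i)) y); rewrite (tr_tr _ _ erefl) tr_id.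
  + by apply: orth_sub (orth_sh (a := -1) oF) => j /=; lia.
  + by move=> j ja; apply/(exact_at_shift _ (subrK 1 j))/eM; lia.
- exists (dg_zero R), (dg_id _), 0, 0; split.
  + by apply: quasi_iso_bij => // i y; exists y.
  + move=> N f _; apply: null_ext (null_zero _ _) => i x.
    by rewrite [x]thinmx0 !linear0.
  + by move=> j _ x _; rewrite [x]thinmx0; apply: (@coboundary0 k (cx_zero k)).
- have [f qf] := quasi_iso_sum qp qq.
  exists (dg_sum F G), f, (Num.max D D'), (Num.min a a'); split=> //.
    by apply: orth_sum; [apply: orth_sub oF|apply: orth_sub oG] => j;
      rewrite le_max => ->; rewrite ?orbT.
  by move=> j; rewrite lt_min => /andP [ja ja']; apply/exact_at_sum; split;
    [apply: eM|apply: eN].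
- exact: bounded_resolution_summand IH.
Qed.

End Compact.

(** * Tensor products *)

Section TensorMaps.
Variables (k : fieldType) (R : dgAlgebra k) (P : dgRight R).
Implicit Types (L M N : dgLeft R).

Definition pure M n i j (h : i + j = n) (p : P i) (x : M j) : tensor P M n :=
  tens_pi [:: Tgen h p x].

Lemma tens_ev_pure M n V (f : balanced P M n V) i j (h : i + j = n) p x :
  tens_ev f (pure h p x) = f i j h p x.
Proof. by rewrite tens_evE /tev big_seq1. Qed.

Lemma pure_linr M n i j (h : i + j = n) (p : P i) : linear (@pure M n i j h p).
Proof.
move=> c x y; apply: tens_ext => V f.
by rewrite [RHS]linearP /= !tens_ev_pure linearP.
Qed.

Lemma pure_linl M n i j (h : i + j = n) (x : M j) :
  linear (fun p => @pure M n i j h p x).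
Proof.
move=> c p q; apply: tens_ext => V f.
by rewrite [RHS]linearP /= !tens_ev_pure bal_linl.
Qed.

Lemma pureA M n a b c ab bc (h1 : a + b = ab) (h2 : ab + c = n)
    (h3 : b + c = bc) (h4 : a + bc = n) (p : P a) (r : R b) (x : M c) :
  pure h2 (ract h1 p r) x = pure h4 p (lact h3 r x).
Proof. by apply: tens_ext => V f; rewrite !tens_ev_pure; apply: balA. Qed.

Definition pure_gen M n (g : tgen P M n) : tensor P M n :=
  let: Tgen _ _ h p x := g in pure h p x.

Lemma tensor_decomp M n (z : tensor P M n) :
  z = \sum_(g <- tens_repr z) pure_gen g.
Proof.
apply: tens_ext => V f; rewrite linear_sum; apply: eq_bigr => -[i j h p x] _.
by rewrite [RHS]tens_ev_pure.
Qed.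

Lemma tensor_linear_ext M n (V : lmodType k) (f g : tensor P M n -> V) :
  linear f -> linear g ->
  (forall i j (h : i + j = n) p x, f (pure h p x) = g (pure h p x)) ->
  forall z, f z = g z.
Proof.
move=> lf lg e z; rewrite (tensor_decomp z).
elim: (tens_repr z) => [|[i j h p x] s IH]; first by rewrite big_nil !lin0.
by rewrite big_cons !linD //= e IH.
Qed.

Lemma d_pure M n n1 (hn : n + 1 = n1) i j (h : i + j = n) (p : P i) (x : M j) :
  cx_d hn (pure h p x) = pure (deg_dl h hn) (cx_d erefl p) x
    + (-1) ^ i *: pure (deg_dr h hn) p (cx_d erefl x).
Proof.
apply: tens_ext => V f; rewrite [LHS]tens_evd tens_ev_pure /=.
by rewrite [RHS]linearD linearZ /= !tens_ev_pure.
Qed.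

(** Homogeneous maps of degree [m], commuting with the action up to the sign
    prescribed by the Koszul rule. *)
Record gmap (m : int) M N := GMap {
  gm :> forall i j : int, i + m = j -> M i -> N j;
  gm_lin : forall i j (h : i + m = j), linear (gm h);
  gm_act : forall (a i j n l : int) (hi : a + i = n) (h : i + m = j)
    (hn : n + m = l) (hj : a + j = l) (r : R a) (x : M i),
    gm hn (lact hi r x) = (-1) ^ (m * a) *: lact hj r (gm h x) }.

Section GradedTensor.
Variables (m : int) (M N : dgLeft R) (f : gmap m M N).

Lemma gm_deg (i j n l : int) : i + j = n -> n + m = l -> i + (j + m) = l.
Proof. by move=> <- <-; rewrite addrA. Qed.

#[local] Obligation Tactic := idtac.
Program Definition gm_balanced (n l : int) (e : n + m = l) :
    balanced P M n (tensor P N l) :=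
  @Balanced k R P M n (tensor P N l)
    (fun i j h p x => (-1) ^ (m * i) *: pure (gm_deg h e) p (f j (j + m) erefl x)) _ _ _.
Next Obligation.
move=> n l e i j h p c x y; rewrite gm_lin pure_linr.
by rewrite scalerDr !scalerA mulrC.
Qed.
Next Obligation.
move=> n l e i j h x c p q; rewrite pure_linl.
by rewrite scalerDr !scalerA mulrC.
Qed.
Next Obligation.
move=> n l e a b c ab bc h1 h2 h3 h4 p r x.
have h3' : b + (c + m) = bc + m by rewrite addrA h3.
rewrite (gm_act f h3 erefl erefl h3') (linZ (pure_linr _ _)) scalerA -sgnD.
rewrite -(pureA h1 (gm_deg h2 e)); congr (_ ^ _ *: _).
by rewrite -mulrDr h1.
Qed.

Definition tensor_gm n l (e : n + m = l) : tensor P M n -> tensor P N l :=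
  tens_ev (gm_balanced e).

Lemma tensor_gm_linear n l (e : n + m = l) : linear (tensor_gm e).
Proof. exact: tens_ev_linear. Qed.
HB.instance Definition _ n l (e : n + m = l) :=
  GRing.isLinear.Build k (tensor P M n) (tensor P N l) _ (tensor_gm e)
    (tensor_gm_linear e).

Lemma tensor_gmE n l (e : n + m = l) i j j' (h : i + j = n) (h' : j + m = j')
    (h'' : i + j' = l) p x :
  tensor_gm e (pure h p x) = (-1) ^ (m * i) *: pure h'' p (f j j' h' x).
Proof.
rewrite /tensor_gm tens_ev_pure /=; case: j' / h' h'' => h''.
by rewrite (eq_irrelevance h'' (gm_deg h e)).
Qed.

End GradedTensor.

Lemma tensor_gm0 m M N (f : gmap m M N) n l (e : n + m = l) z :
  (forall i j (h : i + m = j) x, f i j h x = 0) -> tensor_gm f e z = 0.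
Proof.
move=> f0; apply: (tensor_linear_ext (g := fun _ => 0)).
- exact: tensor_gm_linear.
- by move=> c x y; rewrite scaler0 addr0.
move=> i j h p x; have h'' : i + (j + m) = l by rewrite addrA h.
by rewrite (tensor_gmE f e h erefl h'') f0 (lin0 (pure_linr _ _)) scaler0.
Qed.

(** Both sides carry the Koszul sign, so the commutator of the differential
    with [1 (x) f] is [1 (x) g].  Chain maps are the case [g = 0] and
    null-homotopies of the identity the case [g = id]. *)
Lemma tensor_gm_d m m' M N (f : gmap m M N) (g : gmap m' M N)
    (fg : forall i j l i1 (h : i + m = j) (hj : j + 1 = l) (hi : i + 1 = i1)
      (h1 : i1 + m = l) (hg : i + m' = l) (x : M i),
      cx_d hj (f i j h x) = (-1) ^ m *: f i1 l h1 (cx_d hi x) + g i l hg x)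
    n l n1 l1 (e : n + m = l) (hl : l + 1 = l1) (hn : n + 1 = n1)
    (e1 : n1 + m = l1) (eg : n + m' = l1) (z : tensor P M n) :
  cx_d hl (tensor_gm f e z) =
    (-1) ^ m *: tensor_gm f e1 (cx_d hn z) + tensor_gm g eg z.
Proof.
have em : m' = m + 1.
  by apply: (addrI n); rewrite eg addrA e hl.
move: z; apply: tensor_linear_ext.
- by move=> c x y; rewrite !linearP.
- by move=> c x y; rewrite (cx_lin hn) !tensor_gm_linear !scalerDr !scalerA
    [_ * c]mulrC addrACA.
move=> i j h p x.
have h' : i + (j + m) = l by rewrite addrA h.
have hd : i + (j + m + 1) = l1 by rewrite addrA h'.
have hjg : j + m' = j + m + 1 by rewrite em addrA.
have hj1 : j + 1 + m = j + m + 1 by rewrite addrAC.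
have hi1 : i + 1 + (j + m) = l1 by rewrite addrAC h'.
rewrite (tensor_gmE f e h erefl h') (linZ (cx_lin _)) !d_pure.
rewrite (linD (tensor_gm_linear _ _)) (linZ (tensor_gm_linear _ _)).
rewrite (tensor_gmE f e1 (deg_dl h hn) erefl hi1).
rewrite (tensor_gmE f e1 (deg_dr h hn) hj1 hd).
rewrite (tensor_gmE g eg h hjg hd).
rewrite (fg _ _ _ _ erefl erefl erefl hj1 hjg) (linD (pure_linr _ _)).
rewrite (linZ (pure_linr _ _)) !scalerDr !scalerA -!sgnD addrA.
rewrite (eq_irrelevance (deg_dl h' hl) hi1) (eq_irrelevance (deg_dr h' hl) hd).
congr (_ *: _ + _ ^ _ *: _ + _ *: _).
- by apply: (@sgn_parity _ _ _ (-m)); ring.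
- by ring.
- by rewrite em; congr (_ ^ _); ring.
Qed.

#[local] Obligation Tactic := idtac.
Program Definition gm_null m M N : gmap m M N := @GMap m M N (fun _ _ _ _ => 0) _ _.
Next Obligation. by move=> m M N i j h c x y; rewrite scaler0 addr0. Qed.
Next Obligation. by move=> m M N *; rewrite linear0 scaler0. Qed.

Lemma hom_deg (i j : int) : i + 0 = j -> i = j.
Proof. by rewrite addr0. Qed.

Program Definition gm_hom M N (f : dgHom M N) : gmap 0 M N :=
  @GMap 0 M N (fun i j h x => tr (hom_deg h) (f i x)) _ _.
Next Obligation. by move=> M N f i j h c x y; rewrite !linearP. Qed.
Next Obligation.
move=> M N f a i j n l hi h hn hj r x; rewrite mul0r expr0z scale1r dgh_act.
by rewrite (tr_act _ _ (etrans hi (hom_deg hn))) (act_tr _ _ (etrans hi (hom_deg hn))).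
Qed.

Definition tensor_map M N (f : dgHom M N) n : tensor P M n -> tensor P N n :=
  tensor_gm (gm_hom f) (addr0 n).
Lemma tensor_map_linear M N (f : dgHom M N) n : linear (@tensor_map M N f n).
Proof. exact: tensor_gm_linear. Qed.
HB.instance Definition _ M N (f : dgHom M N) n :=
  GRing.isLinear.Build k (tensor P M n) (tensor P N n) _ (@tensor_map M N f n)
    (@tensor_map_linear M N f n).

Lemma tensor_mapE M N (f : dgHom M N) n i j (h : i + j = n) p x :
  tensor_map f (pure h p x) = pure h p (f j x).
Proof.
rewrite /tensor_map (tensor_gmE _ _ h (addr0 j) h) mul0r expr0z scale1r /=.
by rewrite tr_id.
Qed.

Lemma tensor_map_d M N (f : dgHom M N) n n1 (h : n + 1 = n1) (z : tensor P M n) :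
  tensor_map f (cx_d h z) = cx_d h (tensor_map f z).
Proof.
move: z; apply: tensor_linear_ext; try by move=> c x y; rewrite !linearP.
by move=> i j e p x; rewrite tensor_mapE !d_pure (linD (@tensor_map_linear _ _ f _))
    (linZ (@tensor_map_linear _ _ f _))
    !tensor_mapE dgh_d.
Qed.

(** A null-homotopy of the identity is a map of degree -1 whose commutator with
    the differential is the identity, and tensoring preserves this. *)
Lemma contractible_tensor M n :
  null_homotopic (dg_id M) -> exact_at (tensor P M) n.
Proof.
move=> [s [s1 s2 s3]] z zz.
have hs (i j : int) : i + -1 = j -> j + 1 = i by move=> <-; rewrite subrK.
have fl i j (h : i + -1 = j) : linear (s i j (hs i j h)) by [].
have fa (a i j b l : int) (hi : a + i = b) (h : i + -1 = j)
    (hb : b + -1 = l) (hj : a + j = l) (r : R a) (x : M i) :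
    s b l (hs b l hb) (lact hi r x) =
    (-1) ^ (-1 * a) *: lact hj r (s i j (hs i j h) x).
  by rewrite mulN1r sgn_neg; apply: s2.
pose f := GMap fl fa.
apply/(coboundaryE (subrK 1 n)); exists (tensor_gm f (erefl (n + -1)) z).
have := @tensor_gm_d (-1) 0 M M f (gm_hom (dg_id M)) _ n (n - 1) (n + 1) n
  erefl (subrK 1 n) erefl (addrK 1 n) (addr0 n) z.
rewrite (zz _ erefl) linear0 scaler0 add0r => ->.
  move: z {zz}; apply: tensor_linear_ext => //; try by move=> c x y; rewrite !linearP.
  exact: (tensor_mapE (dg_id M)).
move=> i j l i1 h hj hi h1 hg x /=.
have e : i = l := hom_deg hg.
case: l / e hj h1 hg => hj h1 hg; rewrite tr_id.
rewrite (eq_irrelevance (hs i j h) hj) (eq_irrelevance (hs i1 i h1) hi).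
have /= /esym/(canRL (addrK _)) -> := s3 i j i1 hj hi x.
by rewrite sgn_neg expr1z scaleN1r addrC.
Qed.

End TensorMaps.

(** Forgetting differentials, a cone is a direct sum.  Hence tensoring with [P]
    gives a short exact sequence from [P (x) N] to [P (x) cone f] to the
    suspension of [P (x) M], although [P] need not be flat. *)
Section TensorCone.
Variables (k : fieldType) (R : dgAlgebra k) (P : dgRight R).
Variables (M N : dgLeft R) (f : dgHom M N).

#[local] Obligation Tactic := idtac.
Program Definition cone_pr : gmap 1 (dg_cone f) M :=
  @GMap k R 1 (dg_cone f) M (fun i j h z => tr h z.2) _ _.
Next Obligation. by move=> i j h c x y; rewrite -linearP. Qed.
Next Obligation.
move=> a i j n l hi h hn hj r [y x] /=; rewrite linearZ mul1r /=.
have h' : a + (i + 1) = l by rewrite h.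
by rewrite (tr_act _ _ h') (act_tr _ _ h').
Qed.

Program Definition cone_fst : gmap 0 (dg_cone f) N :=
  @GMap k R 0 (dg_cone f) N (fun i j h z => tr (hom_deg h) z.1) _ _.
Next Obligation. by move=> i j h c x y; rewrite -linearP. Qed.
Next Obligation.
move=> a i j n l hi h hn hj r [y x] /=; rewrite mul0r expr0z scale1r.
by rewrite (tr_act _ _ (etrans hi (hom_deg hn))) (act_tr _ _ (etrans hi (hom_deg hn))).
Qed.

Lemma cone_snd_deg (i j : int) : i + -1 = j -> i = j + 1.
Proof. by move=> <-; rewrite subrK. Qed.

Program Definition cone_snd : gmap (-1) M (dg_cone f) :=
  @GMap k R (-1) M (dg_cone f) (fun i j h x => (0, tr (cone_snd_deg h) x)) _ _.
Next Obligation.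
by move=> i j h c x y; congr pair; rewrite /= ?linearP // scaler0 addr0.
Qed.
Next Obligation.
move=> a i j n l hi h hn hj r x; congr pair; rewrite /= ?linear0 ?scaler0 //.
rewrite mulN1r sgn_neg sgn_scaleK.
have h' : a + i = l + 1 by rewrite hi (cone_snd_deg hn).
by rewrite (tr_act _ _ h') (act_tr _ _ h').
Qed.

Let G := tensor P N.
Let C := tensor P (dg_cone f).
Let B := cx_shift (tensor P M).

Let inj n : {linear G n -> C n} := @tensor_map k R P N (dg_cone f) (cone_in f) n.
Definition tensor_cone_pr n : C n -> B n := tensor_gm cone_pr (erefl (n + 1)).
Lemma tensor_cone_pr_linear n : linear (@tensor_cone_pr n).
Proof. exact: tensor_gm_linear. Qed.
HB.instance Definition _ n :=
  GRing.isLinear.Build k (C n) (B n) _ (@tensor_cone_pr n)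
    (@tensor_cone_pr_linear n).
Let pr n : {linear C n -> B n} := @tensor_cone_pr n.

Let inj_d n m (h : n + 1 = m) x : inj m (cx_d h x) = cx_d h (inj n x).
Proof. exact: tensor_map_d. Qed.

Let pr_d n m (h : n + 1 = m) x : pr m (cx_d h x) = cx_d h (pr n x).
Proof.
case: m / h.
change (tensor_gm cone_pr erefl (cx_d erefl x) =
  - cx_d (degS2 erefl) (tensor_gm cone_pr erefl x)).
rewrite (eq_irrelevance (degS2 erefl) erefl).
have e2 : n + 2 = n + 1 + 1 by rewrite -addrA.
have := @tensor_gm_d k R P 1 2 _ _ cone_pr (gm_null 2 _ _) _ n (n + 1) (n + 1)
  (n + 1 + 1) erefl erefl erefl erefl e2 x.
rewrite (tensor_gm0 (f := gm_null 2 _ _)) // addr0 expr1z scaleN1r => ->.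
  by rewrite opprK.
move=> i j l i1 h hj hi h1 hg [y z]; rewrite scaleN1r /= addr0.
case: j / h hj h1 => hj; case: i1 / hi => h1 /=.
by rewrite (linN (tr_linear _)) opprK (tr_d _ _ hj).
Qed.

Lemma tensor_cone_split n (z : C n) :
  z = inj n (tensor_gm cone_fst (addr0 n) z)
      + tensor_gm cone_snd (addrK 1 n) (pr n z).
Proof.
move: z; apply: (tensor_linear_ext (f := id)) => //.
  by move=> c x y; rewrite !linearP /= -addrACA -scalerDr.
move=> i j h p [y x].
rewrite (tensor_gmE _ _ h (addr0 j) h) mul0r expr0z scale1r [inj n _]tensor_mapE.
have h1 : i + (j + 1) = n + 1 by rewrite addrA h.
rewrite [pr n _](tensor_gmE _ _ h erefl h1) (linZ (tensor_gm_linear _ _)).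
rewrite (tensor_gmE _ _ h1 (addrK 1 j) h) mul1r mulN1r sgn_neg sgn_scaleK.
rewrite -(linD (pure_linr _ _)); congr pure.
by congr pair; rewrite /= !tr_id ?addr0 ?add0r.
Qed.

Let inj_inj n x : inj n x = 0 -> x = 0.
Proof.
move=> e; have : tensor_gm cone_fst (addr0 n) (inj n x) = x.
  move: x {e}; apply: (tensor_linear_ext (g := id)) => //.
    by move=> c x y; rewrite !linearP.
  move=> i j h p x; rewrite [inj n _]tensor_mapE.
  by rewrite (tensor_gmE _ _ h (addr0 j) h) mul0r expr0z scale1r /= tr_id.
by rewrite e linear0.
Qed.

Let pr_surj n y : exists x, pr n x = y.
Proof.
exists (tensor_gm cone_snd (addrK 1 n) y).
move: y; apply: (tensor_linear_ext (g := id)) => //.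
  by move=> c x y; rewrite !linearP.
move=> i j h p x; have h1 : i + (j - 1) = n by rewrite addrA h addrK.
rewrite (tensor_gmE _ _ h erefl h1) [pr n _](linZ (@tensor_cone_pr_linear n)).
rewrite [tensor_cone_pr _](tensor_gmE _ _ h1 (subrK 1 j) h).
by rewrite mul1r mulN1r sgn_neg sgn_scaleK /= (tr_tr _ _ erefl) tr_id.
Qed.

Let pr_inj n x : pr n (inj n x) = 0.
Proof.
move: x; apply: (tensor_linear_ext (g := fun _ => 0)).
- by move=> c x y; rewrite !linearP.
- by move=> c x y; rewrite scaler0 addr0.
move=> i j h p x; have h1 : i + (j + 1) = n + 1 by rewrite addrA h.
rewrite [inj n _]tensor_mapE [pr n _](tensor_gmE _ _ h erefl h1) /=.
by rewrite (lin0 (pure_linr _ _)) scaler0.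
Qed.

Let exact_mid n z : pr n z = 0 -> exists x, inj n x = z.
Proof.
move=> e; exists (tensor_gm cone_fst (addr0 n) z).
by rewrite [RHS]tensor_cone_split e linear0 addr0.
Qed.

Lemma tensor_cone_mid n : exact_at (tensor P N) n ->
  exact_at (tensor P M) (n + 1) -> exact_at (tensor P (dg_cone f)) n.
Proof.
move=> eN /(exact_at_shift _ erefl) eM.
exact: (ses_mid inj_d pr_d inj_inj pr_surj exact_mid eN eM).
Qed.

Lemma tensor_cone_target n : exact_at (tensor P M) n ->
  exact_at (tensor P (dg_cone f)) n -> exact_at (tensor P N) n.
Proof.
move=> /(exact_at_shift _ (subrK 1 n)) eM eC.
exact: (ses_left inj_d pr_d inj_inj pr_surj pr_inj exact_mid (subrK 1 n) eM eC).
Qed.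

Lemma tensor_cone_source n : exact_at (tensor P (dg_cone f)) n ->
  exact_at (tensor P N) (n + 1) -> exact_at (tensor P M) (n + 1).
Proof.
move=> eC eN; apply/(exact_at_shift _ erefl).
exact: (ses_right inj_d pr_d inj_inj pr_surj pr_inj exact_mid erefl eC eN).
Qed.

End TensorCone.

Section TensorSum.
Variables (k : fieldType) (R : dgAlgebra k) (P : dgRight R) (I : choiceType).
Variable F : dgLeft R.

(** An element of the tensor product is a finite sum of pure tensors, each of
    which involves finitely many summands. *)
Lemma tensor_bigsum_finite n (z : tensor P (dg_bigsum I F) n) :
  exists s : seq I, z = \sum_(t <- s)
    tensor_map (bigsum_in F t) (tensor_map (bigsum_pr F t) z).
Proof.
pose supp (g : tgen P (dg_bigsum I F) n) : seq I := let: Tgen _ _ _ _ x := g in fs_list x.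
pose s := undup (flatten (map supp (tens_repr z))).
exists s; rewrite {1 2}(tensor_decomp z).
have : forall g, List.In g (tens_repr z) -> {subset supp g <= s}.
  rewrite /s; elim: (tens_repr z) => //= g l IH g' [<-|/IH sub'] t.
    by rewrite mem_undup mem_cat => ->.
  by move/sub'; rewrite !mem_undup mem_cat => ->; rewrite orbT.
have us : uniq s := undup_uniq _.
elim: (tens_repr z) => [|g l IH] sl.
  by rewrite big_nil big1 // => t _; rewrite !linear0.
rewrite big_cons {1}IH => [|g' lg']; last by apply: sl; right.
rewrite [in RHS](eq_bigr (fun t =>
   tensor_map (bigsum_in F t) (tensor_map (bigsum_pr F t) (pure_gen g))
   + tensor_map (bigsum_in F t)
        (tensor_map (bigsum_pr F t) (\sum_(g <- l) pure_gen g)))); last first.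
  by move=> t _; rewrite !linearD.
rewrite big_split; congr (_ + _).
have {sl} := sl g (or_introl erefl); case: g => i j h p x /= sx.
rewrite (eq_bigr (fun t => pure h p (fs_single t (x t) : dg_bigsum I F j))); last first.
  by move=> t _; rewrite !tensor_mapE.
transitivity (pure h p (fs_sum (@fs_single k I (F j)) x : dg_bigsum I F j)).
  by rewrite fs_decomp.
have lp t : linear (fun v : F j => pure h p (fs_single t v : dg_bigsum I F j)).
  by move=> c u v; rewrite fs_single_linear; apply: pure_linr.
rewrite (fs_sum_comp _ _ (pure_linr h p)) (fs_sumE lp us) // => t ts.
by apply: fs_listP; apply: contra ts; apply: sx.
Qed.

Lemma exact_tensor_bigsum n :
  exact_at (tensor P F) n -> exact_at (tensor P (dg_bigsum I F)) n.
Proof.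
move=> eF z zz; have [s ->] := tensor_bigsum_finite z.
elim: s => [|t s IH]; first by rewrite big_nil; apply: coboundary0.
rewrite big_cons; apply: coboundaryD => //.
have /eF [i [h [y <-]]] : cocycle (tensor_map (bigsum_pr F t) z).
  by move=> l hl; rewrite -tensor_map_d zz linear0.
by rewrite tensor_map_d; apply: coboundary_d.
Qed.

Lemma exact_tensor_summand (t : I) n :
  exact_at (tensor P (dg_bigsum I F)) n -> exact_at (tensor P F) n.
Proof.
move=> eF z zz.
have /eF [i [h [y ey]]] : cocycle (tensor_map (bigsum_in F t) z).
  by move=> l hl; rewrite -tensor_map_d zz linear0.
have -> : z = tensor_map (bigsum_pr F t) (tensor_map (bigsum_in F t) z).
  move: z {zz y ey}; apply: (tensor_linear_ext (f := id)) => //.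
    by move=> c x y; rewrite !linearP.
  by move=> i' j h' p x; rewrite !tensor_mapE /= eqxx.
by rewrite -ey tensor_map_d; apply: coboundary_d.
Qed.

End TensorSum.

(** [P (x) R[b]] is [P[b]], by [p (x) r |-> +- p r]. *)
Section TensorRegular.
Variables (k : fieldType) (R : dgAlgebra k) (P : dgRight R) (b : int).
Let E := dg_sh b (dg_regular R).

Lemma ract_tr (i j l n : int) (e : j = l) (h : i + l = n) (h' : i + j = n)
    (p : P i) (r : R j) : ract h p (tr e r) = ract h' p r.
Proof. by case: l / e h => h; rewrite tr_id (eq_irrelevance h h'). Qed.

#[local] Obligation Tactic := idtac.
Program Definition mul_balanced n : balanced P E n (cx_sh b P n) :=
  @Balanced k R P E n (cx_sh b P n)
    (fun i j h p r => (-1) ^ (b * i) *: ract (sh_deg b h) p (r : R (j + b))) _ _ _.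
Next Obligation.
move=> n i j h p c x y; rewrite [ract _ _ _]linearP scalerDr !scalerA mulrC.
by [].
Qed.
Next Obligation.
move=> n i j h x c p q; rewrite (ract_linl (sh_deg b h) x c p q).
by rewrite scalerDr !scalerA mulrC.
Qed.
Next Obligation.
move=> n a1 a2 a3 a12 a23 h1 h2 h3 h4 p r x.
rewrite [in RHS]/= linearZ /= scalerA -sgnD -mulrDr h1.
by rewrite (ractA h1 (sh_deg b h2) (sh_deg b h3) (sh_deg b h4)).
Qed.

Definition mul_tensor n : tensor P E n -> cx_sh b P n := tens_ev (mul_balanced n).

Lemma mul_tensor_linear n : linear (@mul_tensor n).
Proof. exact: tens_ev_linear. Qed.
HB.instance Definition _ n :=
  GRing.isLinear.Build k (tensor P E n) (cx_sh b P n) _ (@mul_tensor n)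
    (@mul_tensor_linear n).

Lemma mul_tensorE n i j (h : i + j = n) p (r : E j) :
  mul_tensor (pure h p r) = (-1) ^ (b * i) *: ract (sh_deg b h) p (r : R (j + b)).
Proof. exact: tens_ev_pure. Qed.

Lemma mul_tensor_d n m (h : n + 1 = m) z :
  mul_tensor (cx_d h z) = cx_d h (mul_tensor z).
Proof.
move: z; apply: tensor_linear_ext.
- by move=> c x y; rewrite (cx_lin h) mul_tensor_linear.
- by move=> c x y; rewrite mul_tensor_linear (cx_lin h).
move=> i j e p r; rewrite d_pure (linD (@mul_tensor_linear m)).
rewrite (linZ (@mul_tensor_linear m)) !mul_tensorE /=.
rewrite (linZ (ract_linr _ _)) [in RHS]linearZ /=.
rewrite (ract_leibniz (sh_deg b e) (sh_deg_d b h) (erefl (i + 1)) (sh_deg_d b erefl)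
  (sh_deg b (deg_dl e h)) (sh_deg b (deg_dr e h))).
rewrite !scalerDr !scalerA -!sgnD; congr (_ ^ _ *: _ + _ ^ _ *: _); ring.
Qed.

Let unit_deg (n : int) : n + b + - b = n := addrK b n.

Lemma mul_tensor_bij n : exists g : cx_sh b P n -> tensor P E n,
  cancel (@mul_tensor n) g /\ cancel g (@mul_tensor n).
Proof.
pose one : E (- b) := tr (esym (addNr b)) (dga_one R).
exists (fun p => (-1) ^ (b * (n + b)) *: pure (unit_deg n) p one); split; last first.
  move=> p /=; rewrite (linZ (@mul_tensor_linear n)) mul_tensorE sgn_scaleK.
  by rewrite (ract_tr _ _ (addr0 _)) ract1.
have gl : linear (fun p : cx_sh b P n =>
    (-1) ^ (b * (n + b)) *: pure (unit_deg n) p one : tensor P E n).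
  by move=> c x y; rewrite pure_linl scalerDr !scalerA mulrC.
apply: (tensor_linear_ext (g := id)) => //.
  by move=> c x y; rewrite (@mul_tensor_linear n) gl.
move=> i j h p r; rewrite mul_tensorE.
have h' : j + b + - b = j := addrK b j.
rewrite (linZ (pure_linl _ _)) (pureA (sh_deg b h) (unit_deg n) h' h p r one) /=.
have -> : dga_mul (sh_deg b h') r one = r.
  have := @act_tr k R (dg_regular R) (j + b) 0 (- b + b) (j + b)
    (esym (addNr b)) (sh_deg b h') (addr0 _) r (dga_one R).
  by rewrite /= => ->; rewrite dga_mulr1.
rewrite (linZ (pure_linr _ _)) !scalerA -!sgnD.
rewrite (@sgn_parity _ _ 0 (b * (n + b))) ?expr0z ?scale1r //.
by rewrite -h; ring.
Qed.

Lemma exact_tensor_sh_regular n m : n + b = m ->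
  exact_at (tensor P E) n <-> exact_at P m.
Proof.
move=> h; rewrite -(exact_at_sh _ h) {m h}; split=> ex x zx.
  have [g [gK Kg]] := mul_tensor_bij n.
  have /ex [i [h [y ey]]] : cocycle (g x).
    apply/(cocycleE (erefl (n + 1))); have [g' [g'K _]] := mul_tensor_bij (n + 1).
    apply: (can_inj g'K); rewrite mul_tensor_d Kg zx.
    by rewrite (lin0 (@mul_tensor_linear (n + 1))).
  by exists i, h, (mul_tensor y); rewrite -mul_tensor_d ey Kg.
have [g [gK Kg]] := mul_tensor_bij n.
have /ex [i [h [y ey]]] : cocycle (mul_tensor x).
  by move=> l hl; rewrite -mul_tensor_d zx (lin0 (@mul_tensor_linear l)).
have [g' [g'K Kg']] := mul_tensor_bij i.
by exists i, h, (g' y); apply: (can_inj gK); rewrite mul_tensor_d Kg'.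
Qed.

End TensorRegular.

(** * Attaching the bottom cells *)

Section Basis.
Variables (k : fieldType) (C : complex k) (a : int).
Local Open Scope classical_set_scope.

(** The classes of the elements of [A] are linearly independent in [H^a(C)]. *)
Definition cohomology_free (A : set (C a)) : Prop :=
  (forall x, A x -> cocycle x) /\
  forall (s : seq (C a)) (c : C a -> k), uniq s -> (forall x, x \in s -> A x) ->
    coboundary (\sum_(x <- s) c x *: x) -> forall x, x \in s -> c x = 0.

(** By Zorn, there is a maximal independent set of classes; a cocycle outside
    its span could be added to it. *)
Lemma cohomology_basis : exists A : set (C a), cohomology_free A /\
  forall z, cocycle z -> exists (s : seq (C a)) (c : C a -> k),
    [/\ uniq s, forall x, x \in s -> A x & coboundary (z - \sum_(x <- s) c x *: x)].
Proof.
have [|A [freeA maxA]] := @Zorn_bigcup (C a) cohomology_free.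
  move=> Q Qfree Qtot; split=> [x [X QX Xx]|s c us sQ b x xs].
    exact: (Qfree X QX).1.
  have [X QX sX] : exists2 X, Q X & forall x, x \in s -> X x.
    have [X0 QX0 _] := sQ x xs.
    elim: s sQ {us b xs} => [|y s IH] sQ; first by exists X0.
    have [z zs|X QX sX] := IH; first by apply: sQ; rewrite inE zs orbT.
    have [Y QY Yy] := sQ y (mem_head _ _).
    have [XY|YX] := Qtot X Y QX QY; [exists Y|exists X] => // z; rewrite inE.
      by move=> /orP [/eqP -> //|/sX /XY].
    by move=> /orP [/eqP ->|/sX //]; apply: YX.
  exact: ((Qfree X QX).2 s c us sX b x xs).
exists A; split=> // z zz; apply: contrapT => nspan.
have nAz : ~ A z.
  move=> Az; apply: nspan; exists [:: z], (fun=> 1); split=> //.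
    by move=> x; rewrite inE => /eqP ->.
  by rewrite big_seq1 scale1r subrr; apply: coboundary0.
apply: (maxA (A `|` [set z])).
  by split=> [x|sub]; [left|apply/nAz/sub; right].
split=> [x [/freeA.1 //|-> //]|s c us sA b].
have sA' x : x \in s -> x != z -> A x by move=> /sA [//|->]; rewrite eqxx.
have [zs|zs] := boolP (z \in s); last first.
  apply: (freeA.2 s c us _ b) => x xs; apply: sA' => //.
  by apply: contraNneq zs => <-.
have sA2 x : x \in rem z s -> A x.
  by rewrite mem_rem_uniq // inE => /andP [/= xz xs]; apply: sA'.
have us2 : uniq (rem z s) by apply: rem_uniq.
move: b; rewrite (big_rem z) //=.
have [cz|cz b] := eqVneq (c z) 0.
  rewrite cz scale0r add0r => b x xs.
  have [-> //|xz] := eqVneq x z.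
  by apply: (freeA.2 _ _ us2 sA2 b); rewrite mem_rem_uniq // inE /= xz.
case: nspan; exists (rem z s), (fun x => - (c z)^-1 * c x); split=> //.
have := coboundaryZ (c z)^-1 b.
rewrite scalerDr scalerA mulVf // scale1r scaler_sumr; congr (coboundary (_ + _)).
by rewrite -sumrN; apply: eq_bigr => y _; rewrite scalerA mulNr scaleNr opprK.
Qed.

End Basis.

Section Cells.
Variables (k : fieldType) (R : dgAlgebra k) (F : dgLeft R) (a : int).

(** Extends [1 |-> z] from the generator; the sign undoes the one in the action
    of [R] on its shift. *)
#[local] Obligation Tactic := idtac.
Program Definition cell (z : F a) (zz : cocycle z) :
    dgHom (dg_sh (- a) (dg_regular R)) F :=
  @DGHom k R (dg_sh (- a) (dg_regular R)) F
    (fun i r => (-1) ^ (- a * i) *: lact (subrK a i) (r : R (i - a)) z) _ _ _.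
Next Obligation.
move=> z zz i c x y; rewrite (lact_linl (subrK a i) z c x y).
by rewrite scalerDr !scalerA mulrC.
Qed.
Next Obligation.
move=> z zz i j h r /=; rewrite actZl scalerA -sgnD linearZ /=.
rewrite (lact_leibniz (subrK a i) h (sh_deg_d (- a) h) erefl (subrK a j)
  (etrans (addrA _ _ _) (etrans (congr1 (+%R^~ 1) (subrK a i)) h))) zz.
rewrite linear0 scaler0 addr0; congr (_ *: _).
by rewrite -h; apply: (@sgn_parity _ _ _ (- a)); ring.
Qed.
Next Obligation.
move=> z zz i j n h r x /=; rewrite actZl scalerA -sgnD linearZ /=.
rewrite (lactA (sh_deg (- a) h) (subrK a n) (subrK a j) h).
congr (_ *: _); rewrite -h; apply: (@sgn_parity _ _ _ (- a * i)); ring.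
Qed.

Variable A : set (F a).
Definition basis_index := {x : F a | `[< A x >]}.
HB.instance Definition _ := Choice.on basis_index.
Hypothesis A_cocycle : forall x, A x -> cocycle x.

Definition cells : dgLeft R :=
  dg_bigsum basis_index (dg_sh (- a) (dg_regular R)).

Definition cells_map : dgHom cells F :=
  bigsum_out (fun t : basis_index => cell (A_cocycle (asboolW (valP t)))).

Hypothesis R_neg : forall (j : int) (r : R j), j < 0 -> r = 0.
Hypothesis R_deg0 : bijective (fun c : k => c *: dga_one R).
Hypothesis R_deg1 : forall r : R 1, r = 0.
Hypothesis A_free : cohomology_free A.
Hypothesis A_span : forall z, cocycle z -> exists (s : seq (F a)) (c : F a -> k),
    [/\ uniq s, forall x, x \in s -> A x & coboundary (z - \sum_(x <- s) c x *: x)].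
Hypothesis F_low : forall j, j < a -> exact_at F j.

Lemma scalar_deg0 m (e : 0 = m) (r : R m) : exists c, r = tr e (c *: dga_one R).
Proof.
by case: m / e r => r; have [g gK Kg] := R_deg0; exists (g r); apply: esym (Kg r).
Qed.

Lemma cells_zero n (x : cells n) : n < a \/ n = a + 1 -> x = 0.
Proof.
move=> na; apply: fs_ext => t.
have : forall m (r : R m), m < 0 \/ m = 1 -> r = 0.
  by move=> m r [m0|e]; [apply: R_neg|move: r; rewrite e].
by move=> H; apply: (H (n - a) (x t)); lia.
Qed.

Lemma cell_scalar z (zz : cocycle z) (e : 0 = a - a) (c : k) :
  cell zz a (tr e (c *: dga_one R) : R (a - a)) = ((-1) ^ (- a * a) * c) *: z.
Proof.
rewrite /= -scalerA; congr (_ *: _); move: (subrK a a).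
case: _ / e => h; rewrite /tr /= actZl; congr (_ *: _).
exact: lact1.
Qed.

Lemma cells_map_inj (x : cells a) : coboundary (cells_map a x) -> x = 0.
Proof.
have e0 : 0 = a - a by rewrite subrr.
have /choice [c cE] : forall t, exists c, x t = tr e0 (c *: dga_one R) :> R (a - a).
  by move=> t; apply: scalar_deg0.
pose c' (y : F a) := if insub y is Some t then (-1) ^ (- a * a) * c t else 0.
have c'E t : c' (val t) = (-1) ^ (- a * a) * c t by rewrite /c' valK.
have -> : cells_map a x = \sum_(y <- map val (fs_list x)) c' y *: y.
  rewrite big_map; apply: eq_bigr => t _.
  by rewrite c'E -(cell_scalar (A_cocycle (asboolW (valP t))) e0) -cE.
move=> /A_free.2 c0; apply: fs_ext => t.
have [tx|/fs_listP //] := boolP (t \in fs_list x).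
rewrite [LHS]cE; have := c0 _ _ (val t) (map_f _ tx); rewrite c'E.
move=> /(_ _ _)/(congr1 ( *%R ((-1) ^ (- a * a)))); rewrite mulrA sgnK mul1r mulr0.
move=> ->; first by rewrite scale0r linear0.
  by rewrite map_inj_uniq ?fs_list_uniq //; apply: val_inj.
by move=> y /mapP [u _ ->]; apply: asboolW (valP u).
Qed.

Lemma cells_map_surj (z : F a) : cocycle z ->
  exists x : cells a, coboundary (z - cells_map a x).
Proof.
have e0 : 0 = a - a by rewrite subrr.
move=> /A_span [s [c [_ sA bz]]].
suff [x ex] : exists x : cells a, cells_map a x = \sum_(y <- s) c y *: y.
  by exists x; rewrite ex.
elim: s sA {bz} => [|y s IH] sA; first by exists 0; rewrite big_nil linear0.
have [|x ex] := IH; first by move=> u us; apply: sA; rewrite inE us orbT.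
have Ay : `[< A y >] by apply/asboolP/sA/mem_head.
pose t : basis_index := exist _ y Ay.
pose r : R (a - a) := tr e0 (((-1) ^ (- a * a) * c y) *: dga_one R).
exists ((fs_single t (r : dg_sh (- a) (dg_regular R) a) : cells a) + x).
rewrite (linD (@dgh_lin _ _ _ _ cells_map a)) ex big_cons; congr (_ + _).
rewrite [LHS]fs_sum_single => [|u]; last exact: dgh_lin.
by rewrite cell_scalar mulrA sgnK mul1r.
Qed.

(** In a cocycle [(y, x)] of the cone, [x] vanishes: for degree reasons, or, in
    degree [a - 1], because a combination of basis elements that is a
    coboundary is trivial.  Then [y] is a cocycle of degree [<= a], hence a
    combination of basis elements up to a coboundary. *)
Lemma exact_cells_cone n : n <= a -> exact_at (dg_cone cells_map) n.
Proof.
move=> na [y x] /cone_cocycle [ey zx].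
have x0 : x = 0.
  have [en|/eqP en] := eqVneq (n + 1) a; last by apply: cells_zero; lia.
  have bx : coboundary (cells_map (n + 1) x).
    apply/(coboundaryE (erefl (n + 1))); exists (- y); rewrite (linN (cx_lin _)).
    by have /eqP := ey; rewrite addr_eq0 => /eqP ->; rewrite opprK.
  by move: x bx {ey zx}; rewrite en; apply: cells_map_inj.
have zy : cocycle y.
  apply/(cocycleE erefl); move: ey; rewrite x0.
  by rewrite [cells_map _ _](lin0 (@dgh_lin _ _ _ _ cells_map _)) addr0.
have hn := subrK 1 n.
have [x' [dx' /(coboundaryE hn) [w ew]]] : exists x' : cells n,
    cx_d (erefl (n + 1)) x' = 0 /\ coboundary (y - cells_map n x').
  have [an|an] := eqVneq n a; last first.
    exists 0; rewrite linear0; split=> //; rewrite linear0 subr0.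
    by apply: F_low zy; rewrite lt_neqAle an.
  move: y zy {ey zx x x0 hn na}; rewrite an => y /cells_map_surj [x' bx'].
  by exists x'; split=> //; apply: cells_zero; right.
apply: (@cone_coboundary _ _ _ _ _ _ _ hn w x').
  by rewrite ew subrK.
by rewrite dx' oppr0; exact: x0.
Qed.

End Cells.

(** * Bounds for the cohomology of the tensor product *)

Section Induction.
Variables (k : fieldType) (R : dgAlgebra k).
Implicit Types (F : dgLeft R) (P : dgRight R).

(** Tensoring with [F] raises the infimum by exactly [b] and the supremum by
    exactly [d].  Both are stated without assuming that they are attained, so
    that the statement passes through exact sequences. *)
Definition tensor_bounds F (b d : int) : Prop := b <= d /\ forall P,
  [/\ forall i, (forall j, j < i -> exact_at P j) ->
        forall j, j < i + b -> exact_at (tensor P F) j,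
      forall i, (forall j, j < i -> exact_at P j) ->
        exact_at (tensor P F) (i + b) -> exact_at P i,
      forall s, (forall j, s < j -> exact_at P j) ->
        forall j, s + d < j -> exact_at (tensor P F) j &
      forall s, (forall j, s < j -> exact_at P j) ->
        exact_at (tensor P F) (s + d) -> exact_at P s].

Hypothesis R_neg : forall (j : int) (r : R j), j < 0 -> r = 0.
Hypothesis R_deg0 : bijective (fun c : k => c *: dga_one R).
Hypothesis R_deg1 : forall r : R 1, r = 0.

(** The number [n] bounds how many degrees separate the bottom [a] of the
    cohomology of [F] from the bound [D].  If the cone [C] is contractible, all
    cells have degree [a]; otherwise its lowest cell has degree [> a], and the
    highest cell of [C] is that of [F]. *)
Lemma tensor_bounds_exist (n : nat) : forall (a D : int) F,
  D < a + n%:Z -> orth (fun j => j <= D) F -> (forall j, j < a -> exact_at F j) ->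
  null_homotopic (dg_id F) \/ exists b d, a <= b /\ tensor_bounds F b d.
Proof.
elim: n => [|n IH] a D F Dn oF eF.
  by left; apply: oF => j jD; apply: eF; lia.
have [eFa|neFa] := EM (exact_at F a).
  have [||c|[b [d [ab bd]]]] := IH (a + 1) D F _ oF; first by lia.
  - move=> j ja; have [->//|/eqP jna] := eqVneq j a; apply: eF; lia.
  - by left.
  - by right; exists b, d; split=> //; lia.
have [Da|aD] := ltP D a.
  by left; apply: oF => j jD; apply: eF; lia.
right; have [A [freeA spanA]] := cohomology_basis F a.
pose phi := cells_map freeA.1.
have [t0] : inhabited (basis_index A).
  apply: contrapT => empty; apply: neFa => z /spanA [s [c [_ sA]]].
  case: s sA => [|y s] sA; first by rewrite big_nil subr0.
  have Ay : `[< A y >] by apply/asboolP/sA/mem_head.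
  by case: empty; exists; exists y.
have free P j m : j - a = m ->
    exact_at P m <-> exact_at (tensor P (cells A)) j.
  move=> jm; rewrite -(exact_tensor_sh_regular P jm).
  by split; [apply: exact_tensor_bigsum|apply: exact_tensor_summand].
have oC : orth (fun j => j <= D) (dg_cone phi).
  apply: orth_cone_le => //; apply: orth_bigsum.
  by apply: orth_sub (orth_sh (a := - a) (@orth_regular _ R)) => j /=; lia.
have [||C_null|[b [d [ab [bd C_bounds]]]]] := IH (a + 1) D _ _ oC; first by lia.
- by move=> j ja; apply: exact_cells_cone => //; lia.
- have same P j m : j - a = m -> exact_at P m <-> exact_at (tensor P F) j.
    move=> jm; rewrite (free P j m jm); split=> ex.
      by apply: tensor_cone_target ex _; apply: contractible_tensor C_null.
    have := @tensor_cone_source _ _ P _ _ phi (j - 1).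
    by rewrite subrK; apply=> //; apply: contractible_tensor C_null.
  exists a, a; split=> //; split=> // P; split=> i ei.
  + by move=> j ji; apply/(same P j _ erefl)/ei; lia.
  + by move/(same P (i + a) i (addrK _ _)).
  + by move=> j ji; apply/(same P j _ erefl)/ei; lia.
  + by move/(same P (i + a) i (addrK _ _)).
exists a, d; split=> //; split; first by lia.
move=> P; have [c1 _ c3 c4] := C_bounds P; split=> i ei.
- move=> j ji; apply: (tensor_cone_target (f := phi)).
    by apply/(free P j _ erefl)/ei; lia.
  by apply: (c1 i ei); lia.
- move=> ex; apply/(free P (i + a) i (addrK _ _)).
  have := @tensor_cone_source _ _ P _ _ phi (i + a - 1).
  by rewrite subrK; apply=> //; apply: (c1 i ei); lia.
- move=> j ji; apply: (tensor_cone_target (f := phi)).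
    by apply/(free P j _ erefl)/ei; lia.
  exact: (c3 i ei).
- move=> ex; apply: (c4 i ei); apply: (tensor_cone_mid ex).
  by apply/(free P _ _ erefl)/ei; lia.
Qed.

(** A quasi-isomorphism between K-projective modules has an acyclic K-projective
    cone, which is contractible, so [G] is a homotopy retract of [F]. *)
Lemma orth_transfer (S : int -> Prop) (M F G : dgLeft R) (p : dgHom F M) (q : dgHom G M) :
  quasi_iso p -> quasi_iso q -> orth S F -> orth (fun _ => True) G -> orth S G.
Proof.
move=> qp qq oF oG.
have [g pg] := lift_quasi_iso q oG qp.
have qg : quasi_iso g.
  move=> i; have pgE (x : G i) : cocycle x -> coboundary (p i (g i x) - q i x).
    exact: null_coboundary pg.
  split=> [x zx bgx|y zy].
    apply: (qq i).1 => //; have -> : q i x = p i (g i x) - (p i (g i x) - q i x).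
      by rewrite subKr.
    by apply: coboundaryB; [apply: hom_coboundary|apply: pgE].
  have [x [zx bx]] := (qq i).2 _ (hom_cocycle p zy).
  exists x; split=> //; apply: (quasi_iso_injB qp) => //; first exact: hom_cocycle.
  by apply: coboundary_trans bx; apply: pgE.
have oC : orth (fun _ => True) (dg_cone g).
  apply: orth_cone; first exact: orth_K_projective oF.
  exact: (orth_sh (a := 1) oG).
have [|h hg] := @cone_contractible _ _ _ _ g.
  by apply: oC => j _; apply: quasi_iso_cone.
exact: orth_retract hg oF.
Qed.

End Induction.

(** * Amplitudes *)

Section Amplitude.
Variable k : fieldType.
Implicit Types C : complex k.
Local Open Scope classical_set_scope.

Lemma supremum_eq (A : set (\bar int)) x0 x y :
  A y -> supremums A x -> supremum x0 A = x.
Proof.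
move=> Ay Ax; rewrite /supremum ifF; last by apply/eqP => A0; rewrite A0 in Ay.
by apply: (is_subset1_supremums _ Ax); apply: xgetPex; exists x.
Qed.

Lemma infimum_eq (A : set (\bar int)) x0 x y :
  A y -> infimums A x -> infimum x0 A = x.
Proof.
move=> Ay Ax; rewrite /infimum ifF; last by apply/eqP => A0; rewrite A0 in Ay.
by apply: (is_subset1_infimums _ Ax); apply: xgetPex; exists x.
Qed.

Lemma cx_sup_max C s :
  H_nonzero C s -> (forall j, s < j -> exact_at C j) -> cx_sup C = s%:E.
Proof.
move=> nz ex; apply: (@supremum_eq _ _ _ s%:E); first by exists s.
split=> [_ [j nzj <-]|y ub]; last by apply: ub; exists s.
by rewrite lee_fin leNgt; apply/negP => /ex/exact_atP; apply.
Qed.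

Lemma cx_inf_min C i :
  H_nonzero C i -> (forall j, j < i -> exact_at C j) -> cx_inf C = i%:E.
Proof.
move=> nz ex; apply: (@infimum_eq _ _ _ i%:E); first by exists i.
split=> [_ [j nzj <-]|y lb]; last by apply: lb; exists i.
by rewrite lee_fin leNgt; apply/negP => /ex/exact_atP; apply.
Qed.

Lemma amp_eq C i s : H_nonzero C i -> H_nonzero C s ->
  (forall j, j < i -> exact_at C j) -> (forall j, s < j -> exact_at C j) ->
  amp C = (s - i)%:E.
Proof. by move=> ni ns ei es; rewrite /amp (cx_sup_max ns) ?(cx_inf_min ni). Qed.

Lemma amp_acyclic C : (forall j, exact_at C j) -> amp C = -oo%E.
Proof.
move=> ex.
have e : [set j%:E | j in [set j : int | H_nonzero C j]] = set0 :> set (\bar int).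
  by rewrite -subset0 => x [j nz _]; have /exact_atP := ex j.
by rewrite /amp /cx_sup /cx_inf e supremum0 /infimum eqxx.
Qed.

Lemma int_max (Q : int -> Prop) (j u : int) :
  Q j -> (forall i, Q i -> i <= u) -> exists s, Q s /\ forall i, Q i -> i <= s.
Proof.
move=> Qj ub; have := ub j Qj; have : (`|u - j| <= `|u - j|)%N by [].
move: {2}`|u - j|%N => n; elim: n j Qj => [|n IH] j Qj nj ju.
  by exists j; split=> // i /ub; lia.
have [[i [Qi ji]]|no] := EM (exists i, Q i /\ j < i).
  by apply: (IH i Qi); have := ub i Qi; lia.
by exists j; split=> // i Qi; rewrite leNgt; apply/negP => ji; apply: no; exists i.
Qed.

Lemma int_min (Q : int -> Prop) (j l : int) :
  Q j -> (forall i, Q i -> l <= i) -> exists s, Q s /\ forall i, Q i -> s <= i.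
Proof.
move=> Qj lb; have [||s [Qs sP]] := @int_max (fun i => Q (- i)) (- j) (- l).
- by rewrite opprK.
- by move=> i /lb; lia.
by exists (- s); split=> // i Qi; have := sP (- i); rewrite opprK => /(_ Qi); lia.
Qed.

Lemma cx_sup_cases C j : H_nonzero C j ->
  (exists s, H_nonzero C s /\ forall j, s < j -> exact_at C j) \/ cx_sup C = +oo%E.
Proof.
move=> nz; have [[u /(int_max nz) [s [ns sP]]]|nub] :=
    EM (exists u, forall i, H_nonzero C i -> i <= u); [left|right].
  by exists s; split=> // m sm; apply/exact_atP => /sP; rewrite leNgt sm.
apply: (@supremum_eq _ _ _ j%:E); first by exists j.
split=> [y _|y uy]; first exact: leey.
case: y uy => [u| |] uy //; last by have := uy j%:E; apply; exists j.
by case: nub; exists u => i ni; rewrite -lee_fin; apply: uy; exists i.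
Qed.

Lemma cx_inf_cases C j : H_nonzero C j ->
  (exists i, H_nonzero C i /\ forall j, j < i -> exact_at C j) \/ cx_inf C = -oo%E.
Proof.
move=> nz; have [[l /(int_min nz) [i [ni iP]]]|nlb] :=
    EM (exists l, forall i, H_nonzero C i -> l <= i); [left|right].
  by exists i; split=> // m mi; apply/exact_atP => /iP; rewrite leNgt mi.
apply: (@infimum_eq _ _ _ j%:E); first by exists j.
split=> [y _|y ly]; first exact: leNye.
case: y ly => [u| |] ly //; last by have := ly j%:E; apply; exists j.
by case: nlb; exists u => i ni; rewrite -lee_fin; apply: ly; exists i.
Qed.

Lemma amp_fin_bounds C j : H_nonzero C j -> (amp C < +oo)%E ->
  exists i s, [/\ H_nonzero C i, H_nonzero C s,
    forall j, j < i -> exact_at C j & forall j, s < j -> exact_at C j].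
Proof.
move=> nz; rewrite /amp.
have [[s [ns sP]]|->] := cx_sup_cases nz; have [[i [ni iP]]|->] := cx_inf_cases nz.
- by exists i, s.
- by rewrite (cx_sup_max ns).
- by rewrite (cx_inf_min ni).
- by [].
Qed.

End Amplitude.

Lemma zero_of_contractible_resolution (k : fieldType) (R : dgAlgebra k) (F M : dgLeft R)
    (p : dgHom F M) :
  quasi_iso p -> null_homotopic (dg_id F) -> D_iso M (dg_zero R).
Proof.
move=> qp null; apply: acyclic_D_iso_zero => j.
apply/(quasi_iso_exact _ qp) => x zx.
exact: (null_coboundary null zx).
Qed.

Theorem corollary4p4 (k : fieldType) (R : dgAlgebra k)
    (R_neg : forall (j : int) (r : R j), j < 0 -> r = 0)
    (R_deg0 : bijective (fun c : k => c *: dga_one R))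
    (R_deg1 : forall r : R 1, r = 0)
    (R_fin : locally_finite R)
    (M : dgLeft R) (M_nonzero : ~ D_iso M (dg_zero R)) (M_compact : D_compact M)
    (P : dgRight R) (P_fin : locally_finite P) (P_amp : (amp P < +oo)%E) :
  (amp P <= amp (derived_tensor P M))%E.
Proof.
have [F [p [D [a [qp oF eM]]]]] := compact_bounded_resolution R_neg M_compact.
rewrite /derived_tensor; case: pselect => [e|[]]; last first.
  by exists (Resolution qp (proj2 (K_projectiveP F) (orth_K_projective oF))).
case: (projT1 (cid e)) => G q qq kG /= {e}.
have oG := orth_transfer qp qq oF (proj1 (K_projectiveP G) kG).
have eG j : j < a -> exact_at G j by move=> /eM /(quasi_iso_exact _ qq).
have [|null|[b [d [_ [bd /(_ P) [b1 b2 d1 d2]]]]]] :=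
    @tensor_bounds_exist k R R_neg R_deg0 R_deg1 (absz (D - a + 1)) a D G _ oG eG.
- lia.
- by case: M_nonzero; apply: zero_of_contractible_resolution qq null.
have [acP|/existsNP [j /H_nonzeroP nj]] := EM (forall j, exact_at P j).
  by rewrite (amp_acyclic acP) leNye.
have [i [s [ni ns eiP esP]]] := amp_fin_bounds nj P_amp.
rewrite (amp_eq ni ns) // (@amp_eq _ _ (i + b) (s + d)).
- by rewrite lee_fin; lia.
- by apply/H_nonzeroP => /(b2 i eiP)/exact_atP.
- by apply/H_nonzeroP => /(d2 s esP)/exact_atP.
- exact: b1.
- exact: d1.
Qed.
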